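(* There exist absolute constants $c>0$ and $n_0\in\mathbb{N}$ such that for every $n\geq n_0$ and all isotropic log-concave probability measures $\mu,\nu$ on $\mathbb{R}^n$, $$\mathbb{E}_{\nu}(\varphi_{\mu}):=\int_{\mathbb{R}^n}\varphi_{\mu}(x)\,d\nu(x)\leq \exp\left(-cn/L_{\nu}^2\right).$$
   Context: A log-concave probability measure on $\mathbb{R}^n$ is a Borel probability measure $\mu$ such that $\mu(\lambda A+(1-\lambda)B)\geq \mu(A)^{\lambda}\mu(B)^{1-\lambda}$ for all compact $A,B\subseteq\mathbb{R}^n$ and $\lambda\in(0,1)$, and $\mu(H)<1$ for every hyperplane $H$; it has a log-concave density $f_\mu$. It is isotropic if its barycenter is $0$ and its covariance matrix is the identity. Tukey's half-space depth is $\varphi_\mu(x)=\inf\{\mu(H): H$ a half-space of $\mathbb{R}^n$ containing $x\}$. For isotropic $\nu$, the isotropic constant is $L_\nu=\|f_\nu\|_\infty^{1/n}$ (in general $L_\nu=(\sup f_\nu)^{1/n}[\det\mathrm{Cov}(\nu)]^{1/(2n)}$). *)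

(* Defs.v *)
From HB Require Import structures.
From mathcomp Require Import all_boot all_order all_algebra.
From mathcomp Require Import all_classical all_reals all_analysis.
Set Implicit Arguments. Unset Strict Implicit. Unset Printing Implicit Defensive.
Import Order.TTheory GRing.Theory Num.Theory.
Import numFieldNormedType.Exports.
Local Open Scope classical_set_scope.
Local Open Scope ring_scope.

(* R^n is modelled as n.-tuple R, which mathcomp-analysis equips with the
   product (= Borel) sigma-algebra generated by the coordinate maps. *)
Section defs.
Context {R : realType} {n : nat}.
Notation Rn := (n.-tuple R).

Definition coord (x : Rn) (i : 'I_n) : R := tnth x i.

Definition dotp (x y : Rn) : R := \sum_(i < n) coord x i * coord y i.

Definition lincomb (t : R) (x y : Rn) : Rn :=
  [tuple t * coord x i + (1 - t) * coord y i | i < n].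

Definition minkowski (t : R) (A B : set Rn) : set Rn :=
  [set lincomb t a b | a in A & b in B].

Definition row_of (x : Rn) : 'rV[R]_n := \row_(i < n) coord x i.
Definition compact_set (A : set Rn) : Prop := compact (row_of @` A).

Definition halfspace (H : set Rn) : Prop :=
  exists (theta : Rn) (s : R), theta != [tuple 0 | i < n] /\
    H = [set y | s <= dotp theta y].

Definition hyperplane (H : set Rn) : Prop :=
  exists (theta : Rn) (s : R), theta != [tuple 0 | i < n] /\
    H = [set y | dotp theta y = s].

(* Lebesgue measure on R^n, characterised by its values on closed boxes
   (such a measure on the Borel sets exists and is unique). *)
Definition is_lebesgue (lam : {measure set Rn -> \bar R}) : Prop :=
  forall a b : Rn, (forall i, coord a i <= coord b i) ->
    lam [set x | forall i, coord a i <= coord x i <= coord b i] =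
    (\prod_(i < n) (coord b i - coord a i))%:E.

Definition log_concave_measure (mu : probability Rn R) : Prop :=
  (forall (A B : set Rn) (t : R), compact_set A -> compact_set B ->
     0 < t < 1 ->
     (fine (mu A)) `^ t * (fine (mu B)) `^ (1 - t) <= fine (mu (minkowski t A B)))
  /\ (forall H, hyperplane H -> (mu H < 1)%E).

Definition isotropic (mu : probability Rn R) : Prop :=
  (forall i, mu.-integrable setT (fun x => (coord x i)%:E)) /\
  (forall i j, mu.-integrable setT (fun x => (coord x i * coord x j)%:E)) /\
  (forall i, (\int[mu]_x (coord x i)%:E = 0)%E) /\
  (forall i j, (\int[mu]_x (coord x i * coord x j)%:E = (i == j)%:R%:E)%E).

Definition log_concave_fun (f : Rn -> R) : Prop :=
  (forall x, 0 <= f x) /\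
  forall x y (t : R), 0 < t < 1 ->
    (f x) `^ t * (f y) `^ (1 - t) <= f (lincomb t x y).

Definition is_density (lam : {measure set Rn -> \bar R})
  (mu : probability Rn R) (f : Rn -> R) : Prop :=
  (forall x, 0 <= f x) /\ measurable_fun setT f /\
  forall A, measurable A -> mu A = (\int[lam]_(x in A) (f x)%:E)%E.

Definition depth (mu : probability Rn R) (x : Rn) : \bar R :=
  ereal_inf [set mu H | H in [set H | halfspace H /\ H x]].

(* isotropic constant of an isotropic measure with density f:
   L = (sup f)^(1/n) *)
Definition isotropic_constant (f : Rn -> R) : R :=
  (sup (range f)) `^ (n%:R^-1).

End defs.

(* Main.v *)
Require Import Defs.
From HB Require Import structures.
From mathcomp Require Import all_boot all_order all_algebra.
From mathcomp Require Import all_classical all_reals all_analysis.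
From mathcomp Require Import measurable_realfun.
From mathcomp Require Import ring lra zify.
Set Implicit Arguments. Unset Strict Implicit. Unset Printing Implicit Defensive.
Import Order.TTheory GRing.Theory Num.Theory.
Import numFieldNormedType.Exports.
Import Defs.
Local Open Scope classical_set_scope.
Local Open Scope ring_scope.

(* Idea. Let S be the sum of m independent copies of a mu-distributed vector.
   If every summand lies in the half-space {y | <th, x> <= <th, y>} then S lies
   in {y | m <th, x> <= <th, y>}, so depth_mu(x) ^ m is at most the mass which
   the law of S gives to any half-space bounded by a hyperplane through m x.
   By Prekopa's theorem x |-> P(S \in x + Q) is log-concave for a cube Q; with Q
   of half-side r = sqrt m (the scale of S, whose covariance is m I), its
   superlevel set B at height 64 ^ -2n is closed and convex, carries all but 4 ^ -n
   of the law of S, and has volume at most (C r) ^ n. If m x is outside B,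
   separation gives depth_mu(x) ^ m <= 4 ^ -n, while
   nu {x | m x \in B} <= (L_nu C / sqrt m) ^ n, which is at most 4 ^ -n once m is
   of order L_nu ^ 2. *)

(** * Boxes, closed sets and log-concavity of measures *)

Section measurability.
Context d (T : measurableType d) (R : realType).

Lemma measurable_set_le (f g : T -> R) :
  measurable_fun setT f -> measurable_fun setT g ->
  measurable [set x | f x <= g x].
Proof.
move=> mf mg; have := measurable_fun_ler mf mg.
by move=> /(_ measurableT [set true]); rewrite setTI; exact.
Qed.

Lemma measurable_set_lt (f g : T -> R) :
  measurable_fun setT f -> measurable_fun setT g ->
  measurable [set x | f x < g x].
Proof.
move=> mf mg; have := measurable_fun_ltr mf mg.
by move=> /(_ measurableT [set true]); rewrite setTI; exact.
Qed.

Lemma measurable_set_forall n (P : 'I_n -> set T) :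
  (forall i, measurable (P i)) -> measurable [set x | forall i, P i x].
Proof.
move=> mP; rewrite (_ : mkset _ = \bigcap_(i in setT) P i); last first.
  by apply/seteqP; split => x Px i; [move=> _; exact: Px | exact: Px].
by apply: fin_bigcap_measurable => // i _; exact: mP.
Qed.

End measurability.

Section basics.
Context {R : realType} {n : nat}.
Notation Rn := (n.-tuple R).
Implicit Types (x y : Rn) (A B : set Rn).

Lemma measurable_coord (i : 'I_n) : measurable_fun setT (fun x : Rn => coord x i).
Proof. exact: measurable_tnth. Qed.

Lemma coordE (f : 'I_n -> R) i : coord [tuple f j | j < n] i = f i.
Proof. by rewrite /coord tnth_mktuple. Qed.

Lemma coordP x y : (forall i, coord x i = coord y i) -> x = y.
Proof. exact: eq_from_tnth. Qed.

Definition box x (r : R) : set Rn :=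
  [set y | forall i, `|coord y i - coord x i| <= r].

Definition box_closed A := forall x, ~ A x ->
  exists2 e, 0 < e & forall y, box x e y -> ~ A y.

Definition of_row (v : 'rV[R]_n) : Rn := [tuple v ord0 i | i < n].

Lemma row_ofK : cancel (@row_of R n) of_row.
Proof. by move=> x; apply: coordP => i; rewrite coordE mxE. Qed.

Lemma of_rowK : cancel of_row (@row_of R n).
Proof. by move=> v; apply/rowP => i; rewrite mxE coordE. Qed.

Lemma image_row_of A : @row_of R n @` A = of_row @^-1` A.
Proof.
apply/seteqP; split => v /=; first by move=> [x Ax <-]; rewrite row_ofK.
by move=> Av; exists (of_row v) => //; rewrite of_rowK.
Qed.

Lemma box_closed_row A : box_closed A -> closed (@row_of R n @` A).
Proof.
move=> cA; rewrite image_row_of => v clv; apply: contrapT => /cA [e e0 be].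
have [w [/= Aw bw]] := clv _ (nbhsx_ballx v e e0).
apply: be Aw => i; rewrite !coordE.
have := bw.2 ord0 i; rewrite /ball/= distrC => /ltW; exact.
Qed.

Lemma compact_box_closed A : compact_set A -> box_closed A.
Proof.
rewrite /compact_set => cA x Ax.
have : closed (@row_of R n @` A) by apply: compact_closed => //; exact: norm_hausdorff.
rewrite -openC => oA.
have /nbhs_ballP[e /= e0 be] : nbhs (row_of x) (~` (@row_of R n @` A)).
  apply: open_nbhs_nbhs; split => // -[y Ay] /(can_inj row_ofK) yx.
  by apply: Ax; rewrite -yx.
exists (e / 2); first by rewrite divr_gt0.
move=> y yx Ay; apply: (be (row_of y)); last by exists y.
split => // i j; rewrite !mxE /ball /= distrC (le_lt_trans (yx _))//.
by rewrite ltr_pdivrMr// ltr_pMr// ltr1n.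
Qed.

Lemma measurable_box x r : measurable (box x r).
Proof.
apply: measurable_set_forall => i; apply: measurable_set_le => //.
apply: measurableT_comp => //; apply: measurable_funB => //.
exact: measurable_coord.
Qed.

Lemma box_closed_measurable A : box_closed A -> measurable A.
Proof.
move=> cA; pose q2t (q : n.-tuple rat) : Rn := [tuple ratr (tnth q i) | i < n].
pose F (p : n.-tuple rat * nat) : set Rn :=
  if `[< box (q2t p.1) p.2.+1%:R^-1 `<=` ~` A >]
  then box (q2t p.1) p.2.+1%:R^-1 else set0.
suff -> : A = ~` (\bigcup_p F p).
  apply: measurableC; apply: countable_bigcupT_measurable => //.
  by move=> p; rewrite /F; case: ifP => // _; exact: measurable_box.
apply/seteqP; split => x.
  by move=> Ax [p _]; rewrite /F; case: ifPn => // /asboolP + /[dup] xb => /[apply].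
apply: contra_notP => /cA[e e0 be].
have [k ke] : exists k : nat, k.+1%:R^-1 < e / 2.
  have := archi_boundP (ltW (divr_gt0 ltr01 (divr_gt0 e0 (ltr0Sn R 1)))).
  set k := Num.bound _ => ek; exists k.
  rewrite invf_plt ?posrE ?divr_gt0//.
  by rewrite (lt_trans (_ : _ < k%:R)) ?ltr_nat// -div1r.
have /choice[q qP] : forall i, exists q : rat, `|ratr q - coord x i| < k.+1%:R^-1.
  move=> i; have [|q] := @rat_in_itvoo R (coord x i - k.+1%:R^-1) (coord x i + k.+1%:R^-1).
    by rewrite ltrBlDr -addrA ltrDl addr_gt0// invr_gt0.
  rewrite in_itv/= => qi; exists q; rewrite ltr_distl; exact: qi.
have xb : box (q2t [tuple q i | i < n]) k.+1%:R^-1 x.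
  by move=> i; rewrite coordE tnth_mktuple distrC ltW.
exists ([tuple q i | i < n], k) => //; rewrite /F; case: asboolP => //; case => y yb.
apply: be => i; rewrite -(subrK (ratr (q i)) (coord y i)) -addrA.
rewrite (le_trans (ler_normD _ _))// (splitr e) lerD//.
- by have := yb i; rewrite coordE tnth_mktuple => /le_trans; apply; exact: ltW.
- by rewrite ltW// (lt_trans (qP i)).
Qed.

Lemma box_closed_compact A x r : box_closed A -> A `<=` box x r -> compact_set A.
Proof.
move=> cA Ar; apply: bounded_closed_compact; last exact: box_closed_row.
pose M := r + \big[Num.max/0]_(i < n) `|coord x i|.
exists (Num.max M 0); split; first exact: num_real.
move=> B; rewrite gt_max => /andP[MB B0] _ [y Ay <-].
rewrite /Num.Def.normr/= mx_normrE; apply: bigmax_le => [|[i j] _ /=]; first exact: ltW.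
rewrite mxE (le_trans _ (ltW MB))// -(subrK (coord x j) (coord y j)).
by rewrite (le_trans (ler_normD _ _))// lerD ?Ar//; exact: le_bigmax.
Qed.

Lemma compact_minkowski t A B :
  compact_set A -> compact_set B -> compact_set (minkowski t A B).
Proof.
rewrite /compact_set => cA cB.
pose f (p : 'rV[R]_n * 'rV[R]_n) := t *: p.1 + (1 - t) *: p.2.
rewrite (_ : _ @` _ = f @` ((@row_of R n @` A) `*` (@row_of R n @` B))).
  apply: continuous_compact; last exact: compact_setX.
  apply: continuous_subspaceT => p; rewrite /f.
  apply: cvgD.
  - by apply: cvgZ; [exact: cvg_cst|exact: cvg_fst].
  - by apply: cvgZ; [exact: cvg_cst|exact: cvg_snd].
have lE (a b : Rn) : row_of (lincomb t a b) = f (row_of a, row_of b).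
  by apply/rowP => i; rewrite !mxE coordE.
apply/seteqP; split => v /=.
- move=> [_ [a Aa [b Bb <-]] <-]; exists (row_of a, row_of b) => //=.
  by split; [exists a|exists b].
- move=> [[_ _] /= [[a Aa <-] [b Bb <-]] <-].
  by exists (lincomb t a b) => //; exists a => //; exists b.
Qed.

Lemma box_closedI A B : box_closed A -> box_closed B -> box_closed (A `&` B).
Proof.
move=> cA cB x /not_andP[/cA|/cB] [e e0 be]; exists e => // y /be Py [] //.
Qed.

Lemma box_closed_box x r : box_closed (box x r).
Proof.
move=> y /existsNP[i /negP]; rewrite -ltNge => rlt.
exists ((`|coord y i - coord x i| - r) / 2); first by rewrite divr_gt0// subr_gt0.
move=> z /(_ i) zy /(_ i) zx; move: rlt; apply/negP; rewrite -leNgt.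
set d := `|_ - coord x i| in zy *.
have : d <= `|coord z i - coord y i| + `|coord z i - coord x i|.
  rewrite (distrC (coord z i)) (le_trans _ (ler_normD _ _))//.
  by rewrite addrA subrK.
by move: zy zx; lra.
Qed.

Lemma bigcup_box A : \bigcup_(k : nat) (A `&` box [tuple 0 | i < n] k%:R) = A.
Proof.
apply/seteqP; split => [x [k _ []]//|x Ax].
have [k kP] : exists k : nat, \big[Num.max/0]_(i < n) `|coord x i| <= k%:R.
  exists (Num.bound (\big[Num.max/0]_(i < n) `|coord x i|)); apply/ltW.
  by apply: archi_boundP; apply: bigmax_ge_id.
exists k => //; split => // i; rewrite coordE subr0 (le_trans _ kP)//.
exact: le_bigmax.
Qed.

End basics.

Section log_concave.
Context {R : realType} {n : nat}.
Notation Rn := (n.-tuple R).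
Implicit Types (A B C : set Rn) (mu : probability Rn R).

Lemma fine_le_measure d (T : measurableType d) (mu : probability T R) (A B : set T) :
  measurable A -> measurable B -> A `<=` B -> fine (mu A) <= fine (mu B).
Proof.
move=> mA mB AB; apply: fine_le; rewrite ?fin_num_measure//.
by apply: le_measure; rewrite ?inE.
Qed.

Lemma powR_mean_scale (a b l t : R) : 0 <= a -> 0 <= b -> 0 < l ->
  (l * a) `^ t * (l * b) `^ (1 - t) = l * (a `^ t * b `^ (1 - t)).
Proof.
move=> a0 b0 l0; rewrite !powRM ?(ltW l0)//.
have E : l `^ t * l `^ (1 - t) = l.
  by rewrite -powRD ?(gt_eqF l0) ?implybT// subrKC powRr1// ltW.
by rewrite -[in RHS]E; ring.
Qed.

Lemma powR_mean_le_of_scale (a b c t : R) : 0 <= a -> 0 <= b -> 0 <= c ->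
  (forall l, 0 < l < 1 -> (l * a) `^ t * (l * b) `^ (1 - t) <= c) ->
  a `^ t * b `^ (1 - t) <= c.
Proof.
move=> a0 b0 c0 h; rewrite leNgt; apply/negP => cP.
set P := _ * _ in cP; have P0 : 0 < P by exact: le_lt_trans cP.
have cP1 : c / P < 1 by rewrite ltr_pdivrMr// mul1r.
have cP0 : 0 <= c / P by rewrite divr_ge0// ltW.
have /h : 0 < (c / P + 1) / 2 < 1 by apply/andP; split; lra.
rewrite powR_mean_scale//; last by lra.
rewrite -/P leNgt => /negP; apply.
rewrite -{1}(divfK (lt0r_neq0 P0) c) ltr_pM2r//; lra.
Qed.

Lemma log_concave_closed mu A B C t :
  log_concave_measure mu -> box_closed A -> box_closed B -> measurable C ->
  0 < t < 1 -> (forall a b, A a -> B b -> C (lincomb t a b)) ->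
  fine (mu A) `^ t * fine (mu B) `^ (1 - t) <= fine (mu C).
Proof.
move=> [lc _] cA cB mC t01 ABC.
pose b0 k : set Rn := box [tuple 0 | i < n] k%:R.
have step k : fine (mu (A `&` b0 k)) `^ t * fine (mu (B `&` b0 k)) `^ (1 - t) <=
    fine (mu C).
  have kA : compact_set (A `&` b0 k).
    apply: (@box_closed_compact _ _ _ [tuple 0 | i < n] k%:R); last by move=> x [].
    by apply: box_closedI => //; exact: box_closed_box.
  have kB : compact_set (B `&` b0 k).
    apply: (@box_closed_compact _ _ _ [tuple 0 | i < n] k%:R); last by move=> x [].
    by apply: box_closedI => //; exact: box_closed_box.
  apply: (le_trans (lc _ _ _ kA kB t01)); apply: fine_le_measure => //.
    apply: box_closed_measurable; apply: compact_box_closed.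
    by apply: compact_minkowski; [exact: kA|exact: kB].
  by move=> _ [a [Aa _]] [b [Bb _]] <-; exact: ABC.
have near_mass D : box_closed D -> forall l, l < 1 -> 0 < fine (mu D) ->
    \forall k \near \oo, l * fine (mu D) < fine (mu (D `&` b0 k)).
  move=> cD l l1 D0.
  have mDk k : measurable (D `&` b0 k).
    by apply: measurableI; [exact: box_closed_measurable|exact: measurable_box].
  have : mu (D `&` b0 k) @[k --> \oo] --> mu D.
    rewrite -[in X in _ --> X](bigcup_box D); apply: nondecreasing_cvg_mu => //.
      by apply: bigcup_measurable => k _; exact: mDk.
    move=> k j kj; apply/subsetPset => x [Dx kx]; split => // i.
    by rewrite (le_trans (kx i))// ler_nat.
  rewrite -[mu D]fineK ?fin_num_measure//; last exact: box_closed_measurable.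
  move=> /fine_cvgP[_] /cvgr_gt; apply.
  by rewrite -[ltRHS]mul1r ltr_pM2r.
have [A0|A0] := eqVneq (fine (mu A)) 0.
  by rewrite A0 powR0 ?mul0r ?fine_ge0//; case/andP: t01 => /lt0r_neq0.
have [B0|B0] := eqVneq (fine (mu B)) 0.
  rewrite B0 powR0 ?mulr0 ?fine_ge0//; case/andP: t01 => _.
  by rewrite -subr_gt0 => /lt0r_neq0.
apply: powR_mean_le_of_scale; rewrite ?fine_ge0// => l /andP[l0 l1].
have /= [k _ /(_ k (leqnn k))[Ak Bk]] : \forall k \near \oo,
    l * fine (mu A) < fine (mu (A `&` b0 k)) /\
    l * fine (mu B) < fine (mu (B `&` b0 k)).
  near=> k; split; near: k; apply: near_mass => //;
  by rewrite lt_def ?A0 ?B0 fine_ge0.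
apply: le_trans (step k); apply: ler_pM; rewrite ?powR_ge0//.
all: apply: ge0_ler_powR; rewrite ?nnegrE ?mulr_ge0 ?fine_ge0 ?(ltW l0) ?(ltW Ak) ?(ltW Bk)//.
all: by case/andP: t01 => ? ?; rewrite ?subr_ge0 ltW.
Unshelve. all: by end_near. Qed.

End log_concave.

(** * The Prekopa inequality on the line *)

Section layer_cake.
Context {R : realType}.
Local Notation leb := (@lebesgue_measure R).

Lemma layer_cake d (T : measurableType d) (k : {sigma_finite_measure set T -> \bar R})
    (w : R -> R) (A : set (T * measurableTypeR R)) :
  measurable_fun setT w -> (forall s, 0 <= w s) -> measurable A ->
  (\int[k]_x \int[leb]_s (w s * \1_A (x, s))%:E =
   \int[leb]_s ((w s)%:E * k (ysection A s)))%E.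
Proof.
move=> mw w0 mA.
rewrite (fubini_tonelli (fun p : T * measurableTypeR R => (w p.2 * \1_A p)%:E)).
- apply: eq_integral => s _.
  under eq_integral do rewrite /= EFinM.
  rewrite ge0_integralZl//; last by rewrite lee_fin.
  + congr (_ * _)%E; rewrite -[X in _ = k X]setIT -integral_indic//.
      apply: eq_integral => x _; congr EFin; rewrite !indicE; congr (nat_of_bool _)%:R.
      by apply/idP/idP; rewrite !inE /ysection/= inE.
    exact: measurable_ysection.
  + apply/measurable_EFinP; apply: (@measurableT_comp _ _ _ _ _ _ (\1_A : _ -> R)) => //.
- apply/measurable_EFinP; apply: measurable_funM => //.
  exact: (measurableT_comp mw).
- by move=> p; rewrite lee_fin mulr_ge0.
Qed.

Lemma layer_cake_unit d (T : measurableType d) (k : {sigma_finite_measure set T -> \bar R})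
    (f : T -> R) (a : R) : measurable_fun setT f -> (forall x, 0 <= f x) -> 0 < a ->
  (\int[k]_x (Num.min 1 (f x / a))%:E =
   \int[leb]_s ((\1_`]0%R, 1%R[ s)%:E * k [set x | (a * s <= f x)%R]))%E.
Proof.
move=> mf f0 a0.
have mA : measurable [set p : T * measurableTypeR R | a * p.2 <= f p.1].
  apply: measurable_set_le; last exact: measurableT_comp.
  by apply: measurable_funM => //; exact: measurable_cst.
transitivity (\int[k]_x \int[leb]_s ((\1_`]0%R, 1%R[ s : R) *
    \1_[set p : T * measurableTypeR R | (a * p.2 <= f p.1)%R] (x, s))%:E)%E.
  apply: eq_integral => x _.
  pose I : set R := if f x < a then `]0, f x / a]%classic else `]0, 1[%classic.
  have mI : measurable (I : set (measurableTypeR R)) by rewrite /I; case: ifP.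
  transitivity (\int[leb]_s (\1_I s)%:E)%E.
    rewrite integral_indic// setIT /I; case: ltP => fa /=; rewrite lebesgue_measure_itv/= lte_fin.
      rewrite oppr0 adde0 min_r; last by rewrite ler_pdivrMr// mul1r ltW.
      case: ltP => // h; congr EFin; apply/eqP; rewrite eq_le h divr_ge0//.
      exact: ltW.
    by rewrite ltr01 oppr0 adde0 min_l// ler_pdivlMr// mul1r.
  apply: eq_integral => s _; congr EFin; rewrite !indicE -natrM mulnb; congr (nat_of_bool _)%:R.
  apply/idP/andP; rewrite !inE /I /=.
    case: ltP => fa; rewrite /= !in_itv/= => /andP[s0 s1]; split => //.
    - by rewrite s0 (le_lt_trans s1)// ltr_pdivrMr// mul1r.
    - by rewrite mulrC -ler_pdivlMr.
    - by rewrite s0.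
    - by rewrite (le_trans _ fa)// ger_pMr// ltW.
  move=> []; rewrite in_itv/= => /andP[s0 s1] sf; case: ltP => fa; rewrite /= in_itv/= s0//=.
  by rewrite ler_pdivlMr// mulrC.
rewrite (layer_cake k (w := \1_`]0%R, 1%R[)) //.
apply: eq_integral => s _; congr (_ * k _)%E.
by apply/seteqP; split => x; rewrite /ysection/= inE.
Qed.

End layer_cake.

Section convex_sets.
Context {R : realType}.
Local Notation leb := (@lebesgue_measure R).

Lemma lebesgue_interval_comb (A B C : set R) (t p q : R) : 0 < t < 1 ->
  A !=set0 -> B !=set0 -> A `<=` `[p, q] -> B `<=` `[p, q] ->
  is_interval A -> is_interval B -> measurable C ->
  (forall a b, A a -> B b -> C (t * a + (1 - t) * b)) ->
  (t%:E * leb A + (1 - t)%:E * leb B <= leb C)%E.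
Proof.
move=> /andP[t0 t1] A0 B0 Apq Bpq iA iB mC ABC.
have [->|Cfin] := eqVneq (leb C) +oo%E; first by rewrite leey.
have {}Cfin : leb C \is a fin_num by rewrite ge0_fin_numE// ltey.
rewrite -(fineK Cfin); set c := fine _.
have ord a1 a2 b1 b2 : A a1 -> A a2 -> B b1 -> B b2 -> a1 <= a2 -> b1 <= b2 ->
    t * (a2 - a1) + (1 - t) * (b2 - b1) <= c.
  move=> Aa1 Aa2 Bb1 Bb2 a12 b12.
  have [e|ne] := eqVneq (t * (a2 - a1) + (1 - t) * (b2 - b1)) 0.
    by rewrite e fine_ge0.
  have D0 : 0 < t * (a2 - a1) + (1 - t) * (b2 - b1).
    by rewrite lt_def ne addr_ge0// mulr_ge0// ?subr_ge0// ltW.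
  pose I : set R := `[t * a1 + (1 - t) * b1, t * a2 + (1 - t) * b2]%classic.
  have sub : I `<=` C.
    rewrite /I =>  z /=; rewrite in_itv/= => /andP[z1 z2].
    pose s := (z - (t * a1 + (1 - t) * b1)) / (t * (a2 - a1) + (1 - t) * (b2 - b1)).
    have s0 : 0 <= s by rewrite divr_ge0 ?(ltW D0)// subr_ge0.
    have s1 : s <= 1 by rewrite ler_pdivrMr//; lra.
    have -> : z = t * (a1 + s * (a2 - a1)) + (1 - t) * (b1 + s * (b2 - b1)).
      rewrite [RHS](_ : _ = t * a1 + (1 - t) * b1 +
        s * (t * (a2 - a1) + (1 - t) * (b2 - b1))); last by ring.
      by rewrite divfK//; ring.
    apply: ABC; [apply: (iA a1 a2)|apply: (iB b1 b2)] => //; apply/andP; split; nra.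
  rewrite -lee_fin fineK//.
  have /(le_trans _) -> // : (leb I <= leb C)%E.
    by apply: le_measure; rewrite ?inE// /I.
  rewrite /I lebesgue_measure_itv/= lte_fin -subr_gt0.
  rewrite [X in 0 < X](_ : _ = t * (a2 - a1) + (1 - t) * (b2 - b1)); last by ring.
  by rewrite D0 -EFinB lee_fin; lra.
have all a1 a2 b1 b2 : A a1 -> A a2 -> B b1 -> B b2 ->
    t * (a2 - a1) + (1 - t) * (b2 - b1) <= c.
  move=> Aa1 Aa2 Bb1 Bb2; have [a12|a21] := leP a1 a2; have [b12|b21] := leP b1 b2.
  - exact: ord.
  - by have := ord a1 a2 b1 b1 Aa1 Aa2 Bb1 Bb1 a12 (lexx _); nra.
  - by have := ord a1 a1 b1 b2 Aa1 Aa1 Bb1 Bb2 (lexx _) b12; nra.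
  - by have := ord a1 a1 b1 b1 Aa1 Aa1 Bb1 Bb1 (lexx _) (lexx _); nra.
have hs D : D !=set0 -> D `<=` `[p, q] -> has_sup D /\ has_inf D.
  move=> D0 Dpq; split; split => //; [exists q|exists p] => x /Dpq /=;
    by rewrite in_itv/= => /andP[].
have lebD D : D !=set0 -> D `<=` `[p, q] -> is_interval D ->
    (leb D <= (sup D - inf D)%:E)%E.
  move=> D0 Dpq iD; have [sD nD] := hs _ D0 Dpq.
  have sub : D `<=` `[inf D, sup D]%classic.
    by move=> x Dx /=; rewrite in_itv/= ge_inf ?ub_le_sup//; [exact: sD.2|exact: nD.2].
  apply: (@le_trans _ _ (leb `[inf D, sup D]%classic)).
    by apply: le_measure; rewrite ?inE//; exact: is_interval_measurable.
  rewrite lebesgue_measure_itv/= lte_fin; case: ifPn => _; first by rewrite -EFinB.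
  rewrite lee_fin subr_ge0; case: D0 => x Dx.
  by have := sub _ Dx; rewrite /= in_itv/= => /andP[]; exact: le_trans.
have [sA nA] := hs _ A0 Apq; have [sB nB] := hs _ B0 Bpq.
apply: (@le_trans _ _ (t * (sup A - inf A) + (1 - t) * (sup B - inf B))%:E).
  by rewrite [leRHS]EFinD !EFinM leeD// lee_pmul2l// ?lebD// lte_fin; lra.
rewrite lee_fin.
have h1 a1 b1 b2 : A a1 -> B b1 -> B b2 ->
    sup A <= (c - (1 - t) * (b2 - b1)) / t + a1.
  move=> Aa1 Bb1 Bb2; apply: ge_sup => // a2 Aa2.
  rewrite -lerBlDr ler_pdivlMr//; have := all _ _ _ _ Aa1 Aa2 Bb1 Bb2; lra.
have h2 b1 b2 : B b1 -> B b2 ->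
    sup A - (c - (1 - t) * (b2 - b1)) / t <= inf A.
  by move=> Bb1 Bb2; apply: lb_le_inf => // a1 Aa1; rewrite lerBlDl h1.
have h3 b1 b2 : B b1 -> B b2 -> t * (sup A - inf A) <= c - (1 - t) * (b2 - b1).
  by move=> Bb1 Bb2; have := h2 _ _ Bb1 Bb2; rewrite lerBlDl -lerBlDr ler_pdivlMr// mulrC.
have t1' : 0 < 1 - t by lra.
have h4 b1 : B b1 -> sup B <= (c - t * (sup A - inf A)) / (1 - t) + b1.
  move=> Bb1; apply: ge_sup => // b2 Bb2.
  rewrite -lerBlDr ler_pdivlMr//; have := h3 _ _ Bb1 Bb2; lra.
have h5 : sup B - (c - t * (sup A - inf A)) / (1 - t) <= inf B.
  by apply: lb_le_inf => // b1 Bb1; rewrite lerBlDl h4.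
by move: h5; rewrite lerBlDl -lerBlDr ler_pdivlMr//; lra.
Qed.

Lemma powR_amgm (x y t : R) : 0 <= x -> 0 <= y -> 0 < t < 1 ->
  x `^ t * y `^ (1 - t) <= t * x + (1 - t) * y.
Proof.
move=> x0 y0 /andP[t0 t1]; have t1' : 0 < 1 - t by rewrite subr_gt0.
have := @conjugate_powR R (x `^ t) (y `^ (1 - t)) t^-1 (1 - t)^-1 (powR_ge0 _ _) (powR_ge0 _ _).
rewrite !invr_gt0 !invrK -!powRrM !mulfV ?gt_eqF// !powRr1//.
by rewrite subrKC => /(_ t0 t1' erefl); rewrite [t * x]mulrC [(1 - t) * y]mulrC.
Qed.

End convex_sets.

Section prekopa_line.
Context {R : realType}.
Local Notation leb := (@lebesgue_measure R).

Lemma sup_gt0_of_integral (f : R -> R) : (forall u, 0 <= f u <= 1) ->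
  (\int[leb]_u (f u)%:E != 0)%E -> has_sup (range f) /\ 0 < sup (range f).
Proof.
move=> f01 If.
have sf : has_sup (range f).
  by split; [exists (f 0), 0|exists 1 => _ [u _ <-]; case/andP: (f01 u)].
split => //; rewrite ltNge; apply: contra If => s0.
rewrite integral0_eq// => u _; congr EFin; apply/le_anti.
case/andP: (f01 u) => -> _; rewrite andbT (le_trans _ s0)//.
by apply: ub_le_sup; [exact: sf.2|exists u].
Qed.

(* After dividing f and g by their suprema all levels in ]0, 1[ are nonempty
   intervals, whose lengths satisfy the one-dimensional Brunn-Minkowski inequality;
   integrating over the levels gives the arithmetic-mean version, which is stronger. *)
Lemma prekopa_line (f g h : R -> R) (t : R) : 0 < t < 1 ->
  measurable_fun setT f -> measurable_fun setT g -> measurable_fun setT h ->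
  (forall u, 0 <= f u <= 1) -> (forall u, 0 <= g u <= 1) -> (forall u, 0 <= h u) ->
  (forall s, 0 < s -> is_interval [set u | s <= f u]) ->
  (forall s, 0 < s -> is_interval [set u | s <= g u]) ->
  (forall s, 0 < s -> exists p q, [set u | s <= f u] `<=` `[p, q]) ->
  (forall s, 0 < s -> exists p q, [set u | s <= g u] `<=` `[p, q]) ->
  (forall u v, f u `^ t * g v `^ (1 - t) <= h (t * u + (1 - t) * v)) ->
  (\int[leb]_u (f u)%:E < +oo)%E -> (\int[leb]_u (g u)%:E < +oo)%E ->
  (\int[leb]_u (h u)%:E < +oo)%E ->
  fine (\int[leb]_u (f u)%:E) `^ t * fine (\int[leb]_u (g u)%:E) `^ (1 - t)
    <= fine (\int[leb]_u (h u)%:E).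
Proof.
move=> t01 mf mg mh f01 g01 h0 intf intg bf bg fgh If Ig Ih.
have /andP[t0 t1] := t01; have t1' : 0 < 1 - t by rewrite subr_gt0.
have f0 u : 0 <= f u by case/andP: (f01 u).
have g0 u : 0 <= g u by case/andP: (g01 u).
have I0 (k : R -> R) : (forall u, 0 <= k u) -> (0 <= \int[leb]_u (k u)%:E)%E.
  by move=> k0; apply: integral_ge0 => u _; rewrite lee_fin.
have [If0|If0] := eqVneq (\int[leb]_u (f u)%:E)%E 0%E.
  by rewrite If0 powR0 ?mul0r ?fine_ge0 ?I0// gt_eqF.
have [Ig0|Ig0] := eqVneq (\int[leb]_u (g u)%:E)%E 0%E.
  by rewrite Ig0 powR0 ?mulr0 ?fine_ge0 ?I0// gt_eqF.
have [sf a0] := sup_gt0_of_integral f01 If0; set a := sup _ in a0.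
have [sg b0] := sup_gt0_of_integral g01 Ig0; set b := sup _ in b0.
pose c := a `^ t * b `^ (1 - t).
have c0 : 0 < c by rewrite mulr_gt0 ?powR_gt0.
have level s : 0 < s < 1 ->
    (t%:E * leb [set u | (a * s <= f u)%R] + (1 - t)%:E * leb [set u | (b * s <= g u)%R]
     <= leb [set u | (c * s <= h u)%R])%E.
  move=> /andP[s0 s1].
  have ne (k : R -> R) : has_sup (range k) -> 0 < sup (range k) ->
      [set u | sup (range k) * s <= k u] !=set0.
    move=> sk k0; have e0 : 0 < sup (range k) * (1 - s) by rewrite mulr_gt0// subr_gt0.
    have [_ [u _ <-] ku] := sup_adherent e0 sk; exists u => /=; apply/ltW.
    by move: ku; rewrite mulrBr mulr1 opprB addrC subrK.
  have [p1 [q1 h1]] := bf _ (mulr_gt0 a0 s0); have [p2 [q2 h2]] := bg _ (mulr_gt0 b0 s0).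
  apply: (@lebesgue_interval_comb _ _ _ _ t (Num.min p1 p2) (Num.max q1 q2)) => //.
  - exact: ne.
  - exact: ne.
  - move=> u /h1 /=; rewrite !in_itv/= => /andP[pu uq].
    by rewrite ge_min pu le_max uq.
  - move=> u /h2 /=; rewrite !in_itv/= => /andP[pu uq].
    by rewrite ge_min pu le_max uq !orbT.
  - by apply: intf; rewrite mulr_gt0.
  - by apply: intg; rewrite mulr_gt0.
  - by apply: measurable_set_le => //; exact: measurable_cst.
  - move=> u v /= fu gv; apply: le_trans (fgh u v).
    rewrite /c mulrC -powR_mean_scale ?(ltW a0) ?(ltW b0)// ![s * _]mulrC.
    apply: ler_pM; rewrite ?powR_ge0//; apply: ge0_ler_powR => //;
      by rewrite ?nnegrE ?mulr_ge0// ltW.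
have ind0 s : 0 <= (\1_`]0%R, 1%R[ s : R) by [].
have mlev (k : R -> R) (e : R) : measurable_fun setT k ->
    measurable_fun setT (fun s : R => leb [set u | (e * s <= k u)%R]).
  move=> mk.
  pose A := [set p : measurableTypeR R * measurableTypeR R | (e * p.1 <= k p.2)%R].
  have mA : measurable A.
    apply: measurable_set_le; last exact: measurableT_comp.
    by apply: measurable_funM => //; exact: measurable_cst.
  rewrite (_ : (fun s => _) = leb \o xsection A); first exact: measurable_fun_xsection.
  apply/funext => s /=; congr (leb _); apply/seteqP; split => u; rewrite /xsection/= inE//.
have cake : (t%:E * \int[leb]_u (Num.min 1 (f u / a))%:E +
    (1 - t)%:E * \int[leb]_u (Num.min 1 (g u / b))%:E <=
    \int[leb]_u (Num.min 1 (h u / c))%:E)%E.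
  rewrite !layer_cake_unit//.
  have mind : measurable_fun setT (fun s : R => ((\1_`]0%R, 1%R[ s : R)%:E)).
    exact/measurable_EFinP.
  have mil k e : measurable_fun setT k -> measurable_fun setT (fun s : R =>
      ((\1_`]0%R, 1%R[ s)%:E * leb [set u | (e * s <= k u)%R])%E).
    by move=> mk; apply: emeasurable_funM => //; exact: mlev.
  rewrite -!ge0_integralZl ?lee_fin ?(ltW t0) ?(ltW t1')//;
    try by [exact: mil | move=> s _; rewrite mule_ge0// lee_fin].
  rewrite -ge0_integralD//.
  all: try by move=> s _; rewrite !mule_ge0// lee_fin ltW.
  all: try by apply: measurable_funeM; exact: mil.
  apply: ge0_le_integral => //.
  - by move=> s _; rewrite adde_ge0// !mule_ge0// lee_fin ltW.
  - by apply: emeasurable_funD; apply: measurable_funeM; exact: mil.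
  - exact: mil.
  - move=> s _; rewrite indicE; case: (boolP (s \in _)).
      by rewrite inE/= in_itv/= !mul1e => /level.
    by rewrite !mul0e !mule0 adde0.
have div (k : R -> R) (e : R) : measurable_fun setT k -> (forall u, 0 <= k u) ->
    0 < e -> (\int[leb]_u (k u)%:E < +oo)%E ->
    (\int[leb]_u (k u / e)%:E = (fine (\int[leb]_u (k u)%:E) / e)%:E)%E.
  move=> mk k0 e0 Ik; under eq_integral do rewrite mulrC EFinM.
  rewrite ge0_integralZl ?lee_fin ?invr_ge0 ?(ltW e0)//; last 2 first.
  - exact/measurable_EFinP.
  - by move=> u _; rewrite lee_fin.
  by rewrite mulrC EFinM fineK// ge0_fin_numE// I0.
have minE (k : R -> R) : has_sup (range k) -> 0 < sup (range k) ->
    (\int[leb]_u (Num.min 1 (k u / sup (range k)))%:E =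
     \int[leb]_u (k u / sup (range k))%:E)%E.
  move=> sk k0; apply: eq_integral => u _; rewrite min_r// ler_pdivrMr// mul1r.
  by apply: ub_le_sup; [exact: sk.2|exists u].
move: cake; rewrite !minE// !div//.
have : (\int[leb]_u (Num.min 1 (h u / c))%:E <= (fine (\int[leb]_u (h u)%:E) / c)%:E)%E.
  rewrite -div//; apply: ge0_le_integral => //.
  - by move=> u _; rewrite lee_fin le_min ler01 divr_ge0// ltW.
  - apply/measurable_EFinP; apply: measurable_minr; first exact: measurable_cst.
    by apply: measurable_funM => //; exact: measurable_cst.
  - by apply/measurable_EFinP; apply: measurable_funM => //; exact: measurable_cst.
  - by move=> u _; rewrite lee_fin ge_min lexx orbT.
move=> /[swap] /le_trans /[apply]; rewrite -!EFinM -EFinD lee_fin.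
set F := fine _; set G := fine _; set H := fine _ => FGH.
have F0 : 0 <= F / a by rewrite divr_ge0 ?fine_ge0 ?I0// ltW.
have G0 : 0 <= G / b by rewrite divr_ge0 ?fine_ge0 ?I0// ltW.
have := le_trans (powR_amgm F0 G0 t01) FGH.
rewrite ler_pdivlMr// => /(le_trans _); apply.
rewrite /c mulrACA -!powRM ?(ltW a0) ?(ltW b0)// !divfK ?gt_eqF//.
Qed.

End prekopa_line.

(** * The Prekopa inequality for a log-concave measure *)

Section exponential_cake.
Context {R : realType}.
Local Notation leb := (@lebesgue_measure R).

Lemma integral_expRN (b : R) : (\int[leb]_(v in `[b, +oo[) (expR (- v))%:E = (expR (- b))%:E)%E.
Proof.
have dN (x : R) : is_derive x 1 (fun v => - expR (- v)) (expR (- x)).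
  apply: is_derive_eq. by rewrite mulrN1 opprK.
rewrite (@ge0_continuous_FTC2y _ _ (fun v => - expR (- v)) b 0).
- by rewrite -EFinB sub0r opprK.
- by move=> x _; rewrite expR_ge0.
- by apply: continuous_subspaceT => x; apply: continuous_comp;
    [exact: continuousN|exact: continuous_expR].
- rewrite -[X in _ --> X]oppr0; apply: cvgN; exact: cvgr_expR.
- by move=> x _; have [] := dN x.
- apply: cvg_at_right_filter; apply: cvgN; apply: continuous_comp;
    [exact: continuousN|exact: continuous_expR].
- by move=> x _; rewrite derive1E; have [_ ->] := dN x.
Qed.

Lemma expR_powR (x t : R) : expR x `^ t = expR (t * x).
Proof. by rewrite /powR gt_eqF ?expR_gt0// expRK. Qed.

(* The layer cake in logarithmic scale: the integral of a equals that of
   v |-> expR (- v) * k {a >= expR (- v)} over v >= 0. In this scale the geometric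
   means of levels become convex combinations, so log-concavity of k and a makes
   this function log-concave on the line. *)
Definition explevel d (T : measurableType d) (k : probability T R) (a : T -> R) (v : R) : R :=
  \1_`[0, +oo[ v * expR (- v) * fine (k [set y | expR (- v) <= a y]).

Context d (T : measurableType d) (k : probability T R).
Implicit Types a : T -> R.

Lemma explevel_ge0 a v : 0 <= explevel k a v.
Proof. by rewrite /explevel !mulr_ge0 ?expR_ge0 ?fine_ge0. Qed.

Lemma explevel_le a v : measurable_fun setT a -> explevel k a v <= expR (- v).
Proof.
move=> ma; rewrite /explevel indicE -mulrA; case: (v \in _); last by rewrite mul0r expR_ge0.
rewrite mul1r ger_pMr ?expR_gt0// -lee_fin fineK ?fin_num_measure ?probability_le1//.
all: by apply: measurable_set_le => //; exact: measurable_cst.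
Qed.

Lemma explevel_out a v : v < 0 -> explevel k a v = 0.
Proof. by move=> v0; rewrite /explevel indicE memNset ?mul0r//= in_itv/= andbT leNgt v0. Qed.

Lemma explevel_in a v : 0 <= v ->
  explevel k a v = expR (- v) * fine (k [set y | expR (- v) <= a y]).
Proof. by move=> v0; rewrite /explevel indicE mem_set ?mul1r//= in_itv/= andbT. Qed.

Lemma measurable_explevel a : measurable_fun setT a -> measurable_fun setT (explevel k a).
Proof.
move=> ma; apply: measurable_funM.
  apply: measurable_funM => //; exact: measurableT_comp.
apply: measurableT_comp => //.
pose A := [set p : measurableTypeR R * T | expR (- p.1) <= a p.2].
have mA : measurable A.
  by apply: measurable_set_le; apply: measurableT_comp => //; exact: measurableT_comp.
rewrite (_ : (fun s => _) = k \o xsection A); first exact: measurable_fun_xsection.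
by apply/funext => s /=; congr (k _); apply/seteqP; split => u; rewrite /xsection/= inE.
Qed.

Lemma integral_explevel a : measurable_fun setT a -> (forall y, 0 <= a y <= 1) ->
  (\int[leb]_v (explevel k a v)%:E = \int[k]_y (a y)%:E)%E.
Proof.
move=> ma a01.
pose A := [set p : T * measurableTypeR R | expR (- p.2) <= a p.1].
have mA : measurable A.
  by apply: measurable_set_le; apply: measurableT_comp => //; exact: measurableT_comp.
pose w (v : R) : R := \1_`[0, +oo[ v * expR (- v).
transitivity (\int[leb]_s ((w s)%:E * k (ysection A s)))%E.
  apply: eq_integral => v _; rewrite /explevel EFinM; congr (_ * _)%E.
  rewrite (_ : ysection A v = [set y | expR (- v) <= a y]); last first.
    by apply/seteqP; split => y; rewrite /ysection/= inE.
  by rewrite fineK// fin_num_measure//; apply: measurable_set_le => //; exact: measurable_cst.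
rewrite -layer_cake//; last 2 first.
- by apply: measurable_funM => //; exact: measurableT_comp.
- by move=> v; rewrite mulr_ge0 ?expR_ge0.
apply: eq_integral => y _; have /andP[a0 a1] := a01 y.
have [a00|an0] := eqVneq (a y) 0.
  rewrite a00 integral0_eq// => v _; rewrite indicE memNset ?mulr0// /A/= a00.
  by apply/negP; rewrite -ltNge expR_gt0.
have {}a0 : 0 < a y by rewrite lt_def an0.
rewrite -[in RHS](lnK a0) -[ln _]opprK -integral_expRN [RHS]integral_mkcond.
apply: eq_integral => v _; rewrite patchE; case: ifPn; rewrite ?inE ?notin_setE /= in_itv/= andbT.
  move=> lv; rewrite /w !indicE !mem_set ?mulr1 ?mul1r//=.
    by rewrite /A/= -ler_ln ?posrE ?expR_gt0// expRK lerNl.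
  by rewrite in_itv/= andbT (le_trans _ lv)// oppr_ge0; exact: ln_le0.
move=> lv; rewrite indicE memNset ?mulr0//= => h; apply: lv; move: h; rewrite /A/= => h.
by rewrite lerNl -[- v]expRK ler_ln// posrE expR_gt0.
Qed.

End exponential_cake.

Section prekopa.
Context {R : realType} {n : nat}.
Notation Rn := (n.-tuple R).
Local Notation leb := (@lebesgue_measure R).
Implicit Types (a b c : Rn -> R) (mu : probability Rn R).

Definition superlevel_closed a := forall s, 0 < s -> box_closed [set y | s <= a y].

Lemma explevel_comb mu a b c t : log_concave_measure mu -> measurable_fun setT c ->
  superlevel_closed a -> superlevel_closed b ->
  0 < t < 1 -> (forall x y, a x `^ t * b y `^ (1 - t) <= c (lincomb t x y)) ->
  forall u v, explevel mu a u `^ t * explevel mu b v `^ (1 - t) <=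
    explevel mu c (t * u + (1 - t) * v).
Proof.
move=> lc mc ca cb t01 abc u v; have /andP[t0 t1] := t01.
have [u0|u0] := ltP u 0.
  by rewrite explevel_out// powR0 ?mul0r ?explevel_ge0// gt_eqF.
have [v0|v0] := ltP v 0.
  by rewrite (explevel_out _ _ v0)// powR0 ?mulr0 ?explevel_ge0// gt_eqF// subr_gt0.
rewrite !explevel_in//; last by rewrite addr_ge0// mulr_ge0// ?subr_ge0 ltW.
rewrite !powRM ?expR_ge0 ?fine_ge0// mulrACA !expR_powR -expRD.
rewrite [X in expR X](_ : _ = - (t * u + (1 - t) * v)); last by ring.
rewrite ler_pM2l ?expR_gt0//; apply: log_concave_closed => //.
- exact/ca/expR_gt0.
- exact/cb/expR_gt0.
- by apply: measurable_set_le => //; exact: measurable_cst.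
- move=> x y /= ax bY; apply: le_trans (abc x y).
  rewrite [X in expR X](_ : _ = t * - u + (1 - t) * - v); last by ring.
  rewrite expRD -!expR_powR ler_pM ?powR_ge0//; apply: ge0_ler_powR => //;
    by rewrite ?nnegrE ?expR_ge0 ?subr_ge0 ?(ltW t0) ?(ltW t1)//
      (le_trans (expR_ge0 _) ax, le_trans (expR_ge0 _) bY).
Qed.

Lemma prekopa mu a b c t : log_concave_measure mu ->
  measurable_fun setT a -> measurable_fun setT b -> measurable_fun setT c ->
  superlevel_closed a -> superlevel_closed b ->
  (forall x, 0 <= a x <= 1) -> (forall x, 0 <= b x <= 1) -> (forall x, 0 <= c x <= 1) ->
  (forall s x y, 0 < s < 1 -> a x `^ s * a y `^ (1 - s) <= a (lincomb s x y)) ->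
  (forall s x y, 0 < s < 1 -> b x `^ s * b y `^ (1 - s) <= b (lincomb s x y)) ->
  0 < t < 1 -> (forall x y, a x `^ t * b y `^ (1 - t) <= c (lincomb t x y)) ->
  fine (\int[mu]_x (a x)%:E) `^ t * fine (\int[mu]_x (b x)%:E) `^ (1 - t) <=
  fine (\int[mu]_x (c x)%:E).
Proof.
move=> lc ma mb mc ca cb a01 b01 c01 la lb t01 abc.
have fin (e : Rn -> R) : measurable_fun setT e -> (forall x, 0 <= e x <= 1) ->
    (\int[mu]_x (e x)%:E < +oo)%E.
  move=> me e01; apply: (@le_lt_trans _ _ (\int[mu]_x (cst 1%:E) x)%E).
    apply: ge0_le_integral => //.
    - by move=> x _; rewrite lee_fin; case/andP: (e01 x).
    - exact/measurable_EFinP.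
    - by move=> x _; rewrite lee_fin; case/andP: (e01 x).
  rewrite integral_cst// mul1e.
  exact: le_lt_trans (probability_le1 mu measurableT) (ltry 1).
have lev1 e v : measurable_fun setT e -> 0 <= explevel mu e v <= 1.
  move=> me; rewrite explevel_ge0/=; have [v0|v0] := ltP v 0.
    by rewrite explevel_out.
  by rewrite (le_trans (explevel_le _ _ me))// -expR0 ler_expR lerNl oppr0.
have itv e : measurable_fun setT e -> superlevel_closed e -> (forall x, 0 <= e x <= 1) ->
    (forall s x y, 0 < s < 1 -> e x `^ s * e y `^ (1 - s) <= e (lincomb s x y)) ->
    forall s, 0 < s -> is_interval [set u | s <= explevel mu e u].
  move=> me ce e01 le s s0 u v /= su sv z /andP[uz zv].
  have [<-//|uz'] := eqVneq u z; have [->//|zv'] := eqVneq z v.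
  have {uz' uz}uz : u < z by rewrite lt_neqAle uz'.
  have {zv' zv}zv : z < v by rewrite lt_neqAle zv'.
  pose r := (v - z) / (v - u).
  have r01 : 0 < r < 1.
    rewrite divr_gt0 ?subr_gt0//= ?(lt_trans uz)// ltr_pdivrMr ?subr_gt0 ?(lt_trans uz)//.
    by rewrite mul1r ltrD2l ltrN2.
  have -> : z = r * u + (1 - r) * v.
    rewrite /r; field; rewrite subr_eq0 gt_eqF// (lt_trans uz)//.
  apply: le_trans (explevel_comb lc me ce ce r01 _ u v); last first.
    by move=> x y; exact: le.
  have /andP[r0 r1] := r01.
  have sE : s = s `^ r * s `^ (1 - r).
    by rewrite -powRD ?(gt_eqF s0) ?implybT// subrKC powRr1// ltW.
  rewrite [leLHS]sE.
  apply: ler_pM; rewrite ?powR_ge0//; apply: ge0_ler_powR;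
    by rewrite ?nnegrE ?subr_ge0 ?explevel_ge0 ?(ltW s0) ?(ltW r0) ?(ltW r1).
have bd e : measurable_fun setT e ->
    forall s, 0 < s -> exists p q, [set u | s <= explevel mu e u] `<=` `[p, q].
  move=> me s s0; exists 0, (- ln s) => u /= su; rewrite in_itv/=; apply/andP; split.
    by rewrite leNgt; apply/negP => u0; move: su; rewrite explevel_out// leNgt s0.
  by rewrite lerNr -[- u]expRK ler_ln ?posrE ?expR_gt0// (le_trans su)// explevel_le.
rewrite -!(integral_explevel mu)//; apply: prekopa_line => //.
- exact: measurable_explevel.
- exact: measurable_explevel.
- exact: measurable_explevel.
- by move=> u; exact: lev1.
- by move=> u; exact: lev1.
- by move=> u; exact: explevel_ge0.
- exact: itv.
- exact: itv.
- exact: bd.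
- exact: bd.
- by apply: explevel_comb.
- by rewrite integral_explevel// fin.
- by rewrite integral_explevel// fin.
- by rewrite integral_explevel// fin.
Qed.

End prekopa.

(** * Sums of independent copies *)

Lemma integral_probability_cst d (T : measurableType d) (R : realType)
  (P : probability T R) (c : R) : (\int[P]_x c%:E = c%:E)%E.
Proof.
have PT : P [set: T] = 1%E by exact: probability_setT.
by rewrite integral_cst//= [X in (_ * X)%E]PT mule1.
Qed.

Section convolution.
Context {R : realType} {n : nat}.
Notation Rn := (n.-tuple R).
Implicit Types (x y z : Rn) (mu sigma : probability Rn R).

Definition origin : Rn := [tuple 0 | i < n].
Definition addt (p : Rn * Rn) : Rn := [tuple coord p.1 i + coord p.2 i | i < n].
Definition subt x y : Rn := [tuple coord x i - coord y i | i < n].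

Lemma measurable_addt : measurable_fun setT addt.
Proof.
apply/measurable_fun_tnthP => i.
rewrite (_ : _ \o _ = fun p : Rn * Rn => coord p.1 i + coord p.2 i); last first.
  by apply/funext => p /=; exact: coordE.
apply: measurable_funD.
  exact: (measurableT_comp (measurable_coord i) measurable_fst).
exact: (measurableT_comp (measurable_coord i) measurable_snd).
Qed.

HB.instance Definition _ := isMeasurableFun.Build _ _ _ _ addt measurable_addt.

Lemma measurable_subt x : measurable_fun setT (subt x).
Proof.
apply/measurable_fun_tnthP => i.
rewrite (_ : _ \o _ = fun y => coord x i - coord y i); last first.
  by apply/funext => p /=; exact: coordE.
by apply: measurable_funB; [exact: measurable_cst|exact: measurable_coord].
Qed.

Lemma measurable_dotp (th : Rn) : measurable_fun setT (dotp th).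
Proof.
apply: measurable_sum => i; apply: measurable_funM; first exact: measurable_cst.
exact: measurable_coord.
Qed.

Definition convolution mu sigma : probability Rn R :=
  distribution (mu \x sigma)%E addt.

Fixpoint sum_law mu k : probability Rn R :=
  if k is k'.+1 then convolution mu (sum_law mu k') else dirac origin.

Lemma convolutionE mu sigma (A : set Rn) :
  convolution mu sigma A = (\int[mu]_y sigma [set z | A (addt (y, z))])%E.
Proof.
rewrite /convolution /distribution /pushforward/= /product_measure1.
apply: eq_integral => y _ /=; congr (sigma _).
by apply/seteqP; split => z; rewrite /xsection/= inE.
Qed.

Lemma ge0_integral_convolution mu sigma (f : Rn -> \bar R) :
  measurable_fun setT f -> (forall y, 0 <= f y)%E ->
  (\int[convolution mu sigma]_y f y = \int[sigma]_z \int[mu]_y f (addt (y, z)))%E.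
Proof.
move=> mf f0; rewrite ge0_integral_distribution//.
have mfa : measurable_fun setT (f \o addt) := measurableT_comp mf measurable_addt.
have fa0 p : (0 <= (f \o addt) p)%E by exact: f0.
by rewrite (fubini_tonelli1 _ mfa)// -(fubini_tonelli _ mfa).
Qed.

Lemma dotp_addt th y z : dotp th (addt (y, z)) = dotp th y + dotp th z.
Proof.
by rewrite /dotp -big_split/=; apply: eq_bigr => i _; rewrite coordE mulrDr.
Qed.

Lemma sum_law_halfspace mu k th s :
  fine (mu [set y | s <= dotp th y]) ^+ k <=
   fine (sum_law mu k [set y | k%:R * s <= dotp th y]).
Proof.
have mH c : measurable [set y : Rn | c <= dotp th y].
  by apply: measurable_set_le; [exact: measurable_cst|exact: measurable_dotp].
elim: k => [|k IH].
  rewrite expr0 /= /dirac indicE mem_set//= mul0r /dotp big1// => i _.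
  by rewrite coordE mulr0.
have mHa : measurable [set p | k.+1%:R * s <= dotp th (addt p)].
  rewrite -[X in measurable X]setTI.
  exact: (measurable_addt _ (mH (k.+1%:R * s))).
rewrite exprS (le_trans (ler_wpM2l _ IH)) ?fine_ge0//.
rewrite -fineM ?fin_num_measure// -product_measure1E//.
apply: (@fine_le_measure _ _ _ (mu \x sum_law mu k)%E) => //; first exact: measurableX.
move=> [y z] [/= sy kz] /=; rewrite dotp_addt -natr1 mulrDl mul1r addrC.
by rewrite lerD.
Qed.

Lemma sum_law_moment mu k i : isotropic mu ->
  (\int[sum_law mu k]_y (coord y i ^+ 2)%:E = k%:R%:E)%E.
Proof.
move=> [int1 [int2 [m0 m1]]].
have mc2 : measurable_fun setT (fun y : Rn => (coord y i ^+ 2)%:E).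
  by apply/measurable_EFinP; apply: measurable_funX; exact: measurable_coord.
elim: k => [|k IH].
  by rewrite /= integral_dirac//= diracT mul1e coordE expr0n.
rewrite /= ge0_integral_convolution//; last by move=> y; rewrite lee_fin sqr_ge0.
transitivity (\int[sum_law mu k]_z (1%:E + (coord z i ^+ 2)%:E))%E.
  apply: eq_integral => z _.
  under eq_integral => y _.
    rewrite coordE/= (_ : (coord y i + coord z i) ^+ 2 =
      coord y i * coord y i + (coord z i *+ 2 * coord y i + coord z i ^+ 2)); last by ring.
    rewrite !EFinD [X in (_ + (X + _))%E]EFinM.
    over.
  have icst : mu.-integrable setT (EFin \o cst (coord z i ^+ 2)).
    exact: finite_measure_integrable_cst.
  have ilin : mu.-integrable setT (fun y => ((coord z i *+ 2)%:E * (coord y i)%:E)%E).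
    exact: integrableZl.
  rewrite integralD//; last exact: integrableD.
  rewrite integralD// integralZl// m0 mule0 add0e m1 eqxx.
  by rewrite integral_probability_cst.
rewrite ge0_integralD//; last by move=> z _; rewrite lee_fin sqr_ge0.
by rewrite IH integral_probability_cst -EFinD nat1r.
Qed.

End convolution.

Section box_mass.
Context {R : realType} {n : nat}.
Notation Rn := (n.-tuple R).
Implicit Types (x y z : Rn) (mu sigma : probability Rn R).

Definition box_mass sigma (r : R) x : R := fine (sigma (box x r)).

Lemma box_mass_ge0 sigma r x : 0 <= box_mass sigma r x.
Proof. exact: fine_ge0. Qed.

Lemma box_mass_le1 sigma r x : box_mass sigma r x <= 1.
Proof.
rewrite -lee_fin fineK ?fin_num_measure ?probability_le1//; exact: measurable_box.
Qed.

Lemma le_box_mass sigma r s x y : box x r `<=` box y s -> box_mass sigma r x <= box_mass sigma s y.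
Proof. by apply: fine_le_measure; exact: measurable_box. Qed.

Lemma measurable_box_graph d (T : measurableType d) (f g : T -> Rn) (r : R) :
  measurable_fun setT f -> measurable_fun setT g ->
  measurable [set p | box (f p) r (g p)].
Proof.
move=> mf mg; apply: measurable_set_forall => i; apply: measurable_set_le => //.
apply: measurableT_comp => //; apply: measurable_funB.
  exact: (measurableT_comp (measurable_coord i) mg).
exact: (measurableT_comp (measurable_coord i) mf).
Qed.

Lemma measurable_box_mass sigma r : measurable_fun setT (box_mass sigma r).
Proof.
apply: measurableT_comp => //.
have mA := @measurable_box_graph _ _ fst snd r
  (@measurable_fst _ _ Rn Rn) (@measurable_snd _ _ Rn Rn).
rewrite (_ : (fun s => _) = sigma \o xsection [set p : Rn * Rn | box p.1 r p.2]).
  exact: measurable_fun_xsection.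
apply/funext => x /=; congr (sigma _).
by apply/seteqP; split => u; rewrite /xsection/= inE.
Qed.

Lemma box_mass_usc sigma r x (s : R) : box_mass sigma r x < s ->
  exists2 e, 0 < e & forall y, box x e y -> box_mass sigma r y < s.
Proof.
move=> xs; pose F k := box x (r + k.+1%:R^-1).
have FE : \bigcap_k F k = box x r.
  apply/seteqP; split => y.
    move=> Fy i; rewrite leNgt; apply/negP => ry.
    have [k] := ltr_add_invr ry; rewrite ltNge => /negP; apply.
    exact: (Fy k I i).
  by move=> xy k _ i; rewrite (le_trans (xy i))// lerDl invr_ge0.
have ndF : {homo F : a b / (a <= b)%N >-> (b <= a)%O}.
  move=> a b ab; apply/subsetPset => y Fy i; rewrite (le_trans (Fy i))// lerD2l.
  by rewrite lef_pV2 ?posrE// ler_nat.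
have : sigma (F k) @[k --> \oo] --> sigma (box x r).
  rewrite -FE; apply: nonincreasing_cvg_mu => //.
  - by rewrite ltey_eq fin_num_measure//; exact: measurable_box.
  - by move=> k; exact: measurable_box.
  - by rewrite FE; exact: measurable_box.
rewrite -[sigma (box x r)]fineK ?fin_num_measure//; last exact: measurable_box.
move=> /fine_cvgP[_] /cvgr_lt /(_ _ xs) [k _ /(_ k (leqnn k)) /= Fk].
exists k.+1%:R^-1; first by rewrite invr_gt0.
move=> y xy; apply: le_lt_trans Fk; apply: le_box_mass => z yz i.
rewrite -(subrK (coord y i) (coord z i)) -addrA (le_trans (ler_normD _ _))//.
exact: lerD (yz i) (xy i).
Qed.

Lemma superlevel_closed_box_mass sigma r : superlevel_closed (box_mass sigma r).
Proof.
move=> s s0 x /negP; rewrite -ltNge => /box_mass_usc[e e0 xe]; exists e => // y /xe.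
by rewrite /= ltNge => /negP.
Qed.

Lemma box_mass_convolution mu sigma r x :
  box_mass (convolution mu sigma) r x =
  fine (\int[mu]_y (box_mass sigma r (subt x y))%:E).
Proof.
rewrite /box_mass convolutionE; congr fine; apply: eq_integral => y _.
rewrite fineK ?fin_num_measure//; last exact: measurable_box.
congr (sigma _); apply/seteqP.
have E z i : coord (addt (y, z)) i - coord x i = coord z i - coord (subt x y) i.
  by rewrite !coordE/=; ring.
by split => z /= h i; have := h i; rewrite E.
Qed.

Lemma box_mass_sum_law_log_concave mu k r t x y : log_concave_measure mu -> 0 < t < 1 ->
  box_mass (sum_law mu k) r x `^ t * box_mass (sum_law mu k) r y `^ (1 - t) <=
  box_mass (sum_law mu k) r (lincomb t x y).
Proof.
move=> lc; elim: k => [|k IH] in t x y *.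
  move=> /andP[t0 t1].
  have D z : box_mass (dirac origin) r z = \1_(box z r) (origin : Rn) by [].
  rewrite /= !D !indicE; case: (boolP (_ \in box x r)) => [/set_mem xo|_]; last first.
    by rewrite powR0 ?mul0r// gt_eqF.
  case: (boolP (_ \in box y r)) => [/set_mem yo|_]; last first.
    by rewrite powR0 ?mulr0// gt_eqF// subr_gt0.
  rewrite mem_set ?powR1 ?mulr1// => i; have := xo i; have := yo i; rewrite !coordE !sub0r.
  rewrite !normrN => hy hx; rewrite (le_trans (ler_normD _ _))// !normrM.
  rewrite (gtr0_norm t0) (@gtr0_norm _ (1 - t)) ?subr_gt0//.
  have -> : r = t * r + (1 - t) * r by ring.
  by apply: lerD; apply: ler_wpM2l; rewrite ?subr_ge0 ?(ltW t0) ?(ltW t1).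
move=> t01; rewrite !box_mass_convolution.
have m01 z w : 0 <= box_mass (sum_law mu k) r (subt z w) <= 1.
  by rewrite box_mass_ge0 box_mass_le1.
have ms z : measurable_fun setT (fun w => box_mass (sum_law mu k) r (subt z w)).
  by apply: measurableT_comp; [exact: measurable_box_mass|exact: measurable_subt].
have cs z : superlevel_closed (fun w => box_mass (sum_law mu k) r (subt z w)).
  move=> s s0 w /(superlevel_closed_box_mass s0) [e e0 h]; exists e => // v wv.
  apply: h => i; rewrite !coordE distrC.
  rewrite (_ : _ - _ = coord v i - coord w i); [exact: wv|by ring].
have lz z s u v : 0 < s < 1 ->
    box_mass (sum_law mu k) r (subt z u) `^ s * box_mass (sum_law mu k) r (subt z v) `^ (1 - s)
    <= box_mass (sum_law mu k) r (subt z (lincomb s u v)).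
  move=> s01; have -> : subt z (lincomb s u v) = lincomb s (subt z u) (subt z v).
    by apply: coordP => i; rewrite !coordE; ring.
  exact: IH.
apply: prekopa => //.
- by move=> s u v; exact: lz.
- by move=> s u v; exact: lz.
- move=> u v; have -> : subt (lincomb t x y) (lincomb t u v) = lincomb t (subt x u) (subt y v).
    by apply: coordP => i; rewrite !coordE; ring.
  exact: IH.
Qed.

End box_mass.

(** * Volume and tail estimates for box masses *)

Section lebesgue.
Context {R : realType} {n : nat}.
Notation Rn := (n.-tuple R).
Implicit Types (x y z : Rn) (sigma : probability Rn R).
Variable lam : {measure set Rn -> \bar R}.
Hypothesis lamP : is_lebesgue lam.

Lemma lebesgue_box x r : 0 <= r -> (lam (box x r) = ((2 * r) ^+ n)%:E)%E.
Proof.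
move=> r0; pose a : Rn := [tuple coord x i - r | i < n].
pose b : Rn := [tuple coord x i + r | i < n].
rewrite (_ : box x r = [set y | forall i, coord a i <= coord y i <= coord b i]); last first.
  by apply/seteqP; split => y h i; have := h i; rewrite !coordE ler_distl.
rewrite lamP; last by move=> i; rewrite !coordE lerD2l; lra.
congr EFin; rewrite -[in RHS](card_ord n) -prodr_const; apply: eq_bigr => i _.
by rewrite !coordE; ring.
Qed.

Lemma lebesgue_sigma_finite : sigma_finite setT lam.
Proof.
exists (fun k => box origin k%:R).
  by have := bigcup_box (setT : set Rn); under eq_bigcupr do rewrite setTI.
move=> k; split; first exact: measurable_box.
by rewrite lebesgue_box// ltry.
Qed.

Lemma lebesgue_tonelli sigma (f : Rn * Rn -> \bar R) :
  measurable_fun setT f -> (forall p, 0 <= f p)%E ->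
  (\int[lam]_x \int[sigma]_y f (x, y) = \int[sigma]_y \int[lam]_x f (x, y))%E.
Proof.
move=> mf f0.
pose sf := isSFinite.Build _ _ _ (lam : set Rn -> \bar R)
  (sfinite_measure_sigma_finite lebesgue_sigma_finite).
pose mix := isSigmaFinite.Build _ _ _ (lam : set Rn -> \bar R) lebesgue_sigma_finite.
pose l : {sigma_finite_measure set Rn -> \bar R} := HB.pack (lam : set Rn -> \bar R) lam sf mix.
exact: (@fubini_tonelli _ _ _ _ R l sigma f mf f0).
Qed.

Lemma lebesgue_tonelli_indic sigma (A : set (Rn * Rn)) : measurable A ->
  (\int[lam]_x \int[sigma]_y (\1_A (x, y))%:E = \int[sigma]_y \int[lam]_x (\1_A (x, y))%:E)%E.
Proof.
move=> mA; apply: (@lebesgue_tonelli sigma (fun p => (\1_A p)%:E)) => //.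
by apply/measurable_EFinP; exact: measurable_indic.
Qed.

Definition afft (a : R) (b x : Rn) : Rn := [tuple a * coord x i + coord b i | i < n].

Lemma measurable_afft a b : measurable_fun setT (afft a b).
Proof.
apply/measurable_fun_tnthP => i.
rewrite (_ : _ \o _ = fun y => a * coord y i + coord b i); last first.
  by apply/funext => p /=; exact: coordE.
apply: measurable_funD; last exact: measurable_cst.
by apply: measurable_funM; [exact: measurable_cst|exact: measurable_coord].
Qed.

Lemma box_afft a b r x y : 0 < a ->
  box (afft a b x) r y <-> box (afft a^-1 [tuple - a^-1 * coord b i | i < n] y) (r / a) x.
Proof.
move=> a0.
have E i : `|coord y i - coord (afft a b x) i| =
    `|coord x i - coord (afft a^-1 [tuple - a^-1 * coord b i | i < n] y) i| * a.
  rewrite -[X in _ = _ * X](gtr0_norm a0) -normrM distrC; congr `|_|.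
  by rewrite !coordE; field; exact: lt0r_neq0.
by split => h i; have := h i; rewrite E ler_pdivlMr.
Qed.

Lemma integral_box_mass sigma a b r : 0 < a -> 0 <= r ->
  (\int[lam]_x (box_mass sigma r (afft a b x))%:E = ((2 * (r / a)) ^+ n)%:E)%E.
Proof.
move=> a0 r0; pose A := [set p : Rn * Rn | box (afft a b p.1) r p.2].
have mA : measurable A.
  apply: measurable_box_graph => //.
  exact: (measurableT_comp (measurable_afft a b) measurable_fst).
transitivity (\int[lam]_x \int[sigma]_y (\1_A (x, y))%:E)%E.
  apply: eq_integral => x _.
  rewrite /box_mass fineK ?fin_num_measure//; last exact: measurable_box.
  rewrite -[X in sigma X]setIT -integral_indic//; last exact: measurable_box.
rewrite lebesgue_tonelli_indic//.
transitivity (\int[sigma]_y ((2 * (r / a)) ^+ n)%:E)%E; last first.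
  exact: integral_probability_cst.
apply: eq_integral => y _.
rewrite -(lebesgue_box (afft a^-1 [tuple - a^-1 * coord b i | i < n] y)); last first.
  by rewrite divr_ge0// ltW.
rewrite -[X in lam X]setIT -integral_indic//; last exact: measurable_box.
apply: eq_integral => x _; rewrite !indicE; congr ((nat_of_bool _)%:R)%:E.
have h := box_afft b r x y a0.
by apply/idP/idP; rewrite !inE => /h.
Qed.

Lemma volume_box_mass sigma a b r e : 0 < a -> 0 <= r -> 0 < e ->
  (lam [set x | (e <= box_mass sigma r (afft a b x))%R] <= ((2 * (r / a)) ^+ n / e)%:E)%E.
Proof.
move=> a0 r0 e0; rewrite EFinM.
have mg : measurable_fun setT (fun x => box_mass sigma r (afft a b x)).
  by apply: measurableT_comp; [exact: measurable_box_mass|exact: measurable_afft].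
set D := mkset _; have mD : measurable D.
  by apply: measurable_set_le => //; exact: measurable_cst.
rewrite lee_pdivlMr// muleC -(integral_box_mass sigma b a0 r0).
rewrite -[D]setIT -integral_indic// -ge0_integralZl//;
  try by [exact/measurable_EFinP | rewrite lee_fin ltW].
apply: ge0_le_integral => //.
- by move=> x _; rewrite mule_ge0 ?lee_fin// ltW.
- by apply: emeasurable_funM => //; exact/measurable_EFinP.
- exact/measurable_EFinP.
- move=> x _; rewrite -EFinM lee_fin indicE; case: (boolP (x \in D)).
    by rewrite inE /D/= mulr1.
  by rewrite mulr0 box_mass_ge0.
Qed.

(* With p x := box_mass sigma (r / 2) x, the part of sigma on small boxes of
   half-side r / 2 is, up to the factor r ^ n, the integral of p over {p < e}; there
   p <= sqrt (e / p c) * sqrt (p x * p c) <= sqrt (e / p c) * p ((x + c) / 2). *)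
Lemma tail_box_mass sigma r e c : 0 < r -> 0 <= e -> 0 < box_mass sigma (r / 2) c ->
  (forall x, box_mass sigma (r / 2) x `^ 2^-1 * box_mass sigma (r / 2) c `^ (1 - 2^-1) <=
     box_mass sigma (r / 2) (lincomb 2^-1 x c)) ->
  fine (sigma [set y | box_mass sigma r y < e]) <=
    2 ^+ n * Num.sqrt (e / box_mass sigma (r / 2) c).
Proof.
move=> r0 e0 c0 lc; set k := box_mass sigma (r / 2) c in c0 lc *.
set E := mkset _; have mE : measurable E.
  by apply: measurable_set_lt; [exact: measurable_box_mass|exact: measurable_cst].
have r20 : 0 < r / 2 by rewrite divr_gt0.
pose b : Rn := [tuple 2^-1 * coord c i | i < n].
pose A := [set p : Rn * Rn | box p.1 (r / 2) p.2].
have mA : measurable A by exact: measurable_box_graph.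
pose B := A `&` (snd @^-1` E).
have mB : measurable B.
  by apply: measurableI => //; rewrite -[X in measurable X]setTI; exact: measurable_snd.
have key : ((r ^+ n)%:E * sigma E <=
    (Num.sqrt (e / k))%:E * \int[lam]_x (box_mass sigma (r / 2) (afft 2^-1 b x))%:E)%E.
  have -> : ((r ^+ n)%:E * sigma E = \int[lam]_x \int[sigma]_y (\1_B (x, y))%:E)%E.
    rewrite lebesgue_tonelli_indic//.
    rewrite -[E in LHS]setIT -integral_indic// -ge0_integralZl//;
      try by [exact/measurable_EFinP | rewrite lee_fin exprn_ge0// ltW].
    apply: eq_integral => y _.
    have -> : (r ^+ n = (2 * (r / 2)) ^+ n)%R by congr (_ ^+ _)%R; field.
    rewrite -(lebesgue_box y (ltW r20)) indicE; case: (boolP (y \in E)) => yE.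
      rewrite mule1 -[X in lam X]setIT -integral_indic//; last exact: measurable_box.
      apply: eq_integral => x _; rewrite !indicE; congr ((nat_of_bool _)%:R)%:E.
      apply/idP/idP; rewrite !inE /B/A/=.
        move=> h; split; last by rewrite inE in yE.
        by move=> i; rewrite distrC.
      by move=> [h _] i; rewrite distrC.
    rewrite mule0 integral0_eq// => x _; rewrite indicE memNset// => -[_ /= Ey].
    by move: yE; rewrite notin_setE.
  have mg : measurable_fun setT (fun x => box_mass sigma (r / 2) (afft 2^-1 b x)).
    by apply: measurableT_comp; [exact: measurable_box_mass|exact: measurable_afft].
  rewrite -ge0_integralZl//; try by [exact/measurable_EFinP |
    rewrite lee_fin sqrtr_ge0 | move=> x _; rewrite lee_fin box_mass_ge0].
  have mF : measurable_fun setT (fun x => \int[sigma]_y (\1_B (x, y))%:E)%E.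
    apply: (@measurable_fun_fubini_tonelli_F _ _ _ _ _ sigma (fun p => (\1_B p)%:E)) => //.
    exact/measurable_EFinP.
  apply: ge0_le_integral => //.
  - by move=> x _; apply: integral_ge0 => y _; rewrite lee_fin.
  - by apply: emeasurable_funM => //; exact/measurable_EFinP.
  - move=> x _.
    have -> : (\int[sigma]_y (\1_B (x, y))%:E = sigma (E `&` box x (r / 2)))%E.
      have mEb : measurable (E `&` box x (r / 2)).
        by apply: measurableI => //; exact: measurable_box.
      rewrite -[X in sigma X]setIT -integral_indic//.
      apply: eq_integral => y _; rewrite !indicE; congr ((nat_of_bool _)%:R)%:E.
      by apply/idP/idP; rewrite !inE /B/A/= => -[].
    have [->|] := eqVneq (E `&` box x (r / 2)) set0.
      by rewrite measure0 -EFinM lee_fin mulr_ge0 ?sqrtr_ge0 ?box_mass_ge0.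
    move=> /set0P[y [Ey xy]].
    have pe : box_mass sigma (r / 2) x <= e.
      apply: le_trans (ltW Ey); apply: le_box_mass => z xz i.
      rewrite -(subrK (coord x i) (coord z i)) -addrA (le_trans (ler_normD _ _))//.
      have -> : r = r / 2 + r / 2 by field.
      by apply: lerD; [exact: xz|rewrite distrC; exact: xy].
    apply: (@le_trans _ _ (box_mass sigma (r / 2) x)%:E).
      rewrite /box_mass fineK ?fin_num_measure//; last exact: measurable_box.
      by apply: le_measure; rewrite ?inE;
        [apply: measurableI => //; exact: measurable_box|exact: measurable_box|].
    rewrite -EFinM lee_fin; set p := box_mass _ _ x in pe *.
    have p0 : 0 <= p by exact: box_mass_ge0.
    have -> : afft 2^-1 b x = lincomb 2^-1 x c.
      by apply: coordP => i; rewrite !coordE; field.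
    apply: le_trans (ler_wpM2l (sqrtr_ge0 _) (lc x)).
    rewrite (_ : 1 - 2^-1 = 2^-1); last by field.
    rewrite !powR12_sqrt ?box_mass_ge0//.
    rewrite -/p -sqrtrM// mulrC -sqrtrM; last by rewrite mulr_ge0// ltW.
    rewrite (_ : p * k * (e / k) = p * e); last by field; exact: lt0r_neq0.
    by rewrite -[leLHS]ger0_norm// -sqrtr_sqr ler_sqrt ?mulr_ge0// expr2 ler_wpM2l.
move: key; rewrite integral_box_mass ?invr_gt0//; last exact: ltW.
rewrite -[sigma E]fineK ?fin_num_measure// -!EFinM lee_fin.
rewrite (_ : 2 * (r / 2 / 2^-1) = 2 * r); last by field.
rewrite exprMn => h; rewrite -(ler_pM2l (exprn_gt0 n r0)) (le_trans h)//.
by rewrite le_eqVlt; apply/orP; left; apply/eqP; ring.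
Qed.

End lebesgue.

(** * A box of large mass *)

Lemma bin_le_exp2 m k : ('C(m, k) <= 2 ^ m)%N.
Proof.
elim: m k => [|m IH] [|k] //; first by rewrite bin0 expn_gt0.
by rewrite binS expnS mul2n -addnn leq_add.
Qed.

Lemma fine_measure_cover d (T : measurableType d) (R : realType) (P : probability T R)
    (I : eqType) (s : seq I) (F : I -> set T) (G : set T) :
  (forall p, measurable (F p)) -> measurable G ->
  (forall x, G x -> exists2 p, p \in s & F p x) ->
  fine (P G) <= \sum_(p <- s) fine (P (F p)).
Proof.
move=> mF; elim: s G => [|p s IH] G mG cG.
  rewrite big_nil (_ : G = set0) ?measure0//.
  by apply/seteqP; split => x // /cG[].
have mGF : measurable (G `\` F p) by exact: measurableD.
rewrite big_cons; apply: (@le_trans _ _ (fine (P (F p)) + fine (P (G `\` F p)))).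
  rewrite -lee_fin EFinD !fineK ?fin_num_measure//.
  apply: le_trans (measureU2 P _ _) => //.
  apply: le_measure; rewrite ?inE//; first exact: measurableU.
  by move=> x Gx; have [Fx|Fx] := pselect (F p x); [left|right].
apply: lerD => //; apply: IH => // x [/cG[q]]; rewrite inE => /predU1P[->//|qs Fx _].
by exists q.
Qed.

Section mode.
Context {R : realType} {n : nat}.
Notation Rn := (n.-tuple R).
Implicit Types (x y z : Rn) (sigma : probability Rn R).

Definition grid_code := (n.-tuple bool * n.-tuple 'I_(n + n).+1)%type.

Definition grid (r : R) (p : grid_code) : Rn :=
  [tuple (-1) ^+ tnth p.1 i * (r * (tnth p.2 i : nat)%:R) | i < n].

Definition grid_set : {set grid_code} :=
  finset.setX finset.setT [set t : n.-tuple 'I_(n + n).+1 | (\sum_(i <- t) i <= n + n)%N]%SET.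

Lemma card_grid_set : (#|grid_set| <= 16 ^ n)%N.
Proof.
rewrite cardsX cardsT card_tuple card_bool card_partial_ord_partitions.
rewrite (leq_trans (leq_mul (leqnn _) (bin_le_exp2 _ _)))// -expnD.
by rewrite (_ : 16 = 2 ^ 4)%N// -expnM leq_exp2l//; lia.
Qed.

Lemma grid_cover r y : 0 < r -> \sum_(i < n) (coord y i / r) ^+ 2 <= (n + n)%:R ->
  exists2 p, p \in grid_set & box (grid r p) (r / 2) y.
Proof.
move=> r0 yr.
pose u i : R := `|coord y i| / r.
have u0 i : 0 <= u i by rewrite divr_ge0// ltW.
pose m i := Num.trunc (u i + 2^-1).
have mP i : (m i)%:R <= u i + 2^-1 < (m i)%:R + 1.
  by rewrite natr1 truncn_itv// addr_ge0.
have mS : (\sum_(i < n) m i <= n + n)%N.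
  rewrite -(ler_nat R) natr_sum.
  apply: (@le_trans _ _ (\sum_(i < n) ((coord y i / r) ^+ 2 / 2 + 1))).
    apply: ler_sum => i _; case/andP: (mP i) => h _; apply: (le_trans h).
    have -> : (coord y i / r) ^+ 2 = u i ^+ 2.
      by rewrite /u !exprMn real_normK// num_real.
    by have := sqr_ge0 (u i - 1); rewrite sqrrB1; lra.
  rewrite big_split/= -mulr_suml sumr_const card_ord natrD.
  by move: yr; rewrite natrD; lra.
have mi i : (m i < (n + n).+1)%N.
  by rewrite ltnS (leq_trans _ mS)// (bigD1 i)//= leq_addr.
have [t tE] : exists t : n.-tuple 'I_(n + n).+1, forall i, tnth t i = m i :> nat.
  by exists [tuple Ordinal (mi i) | i < n] => i; rewrite tnth_mktuple.
exists ([tuple coord y i < 0 | i < n], t).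
  by rewrite !inE/= big_tuple (leq_trans _ mS)//; under eq_bigr do rewrite tE.
move=> i; rewrite coordE/= tnth_mktuple tE.
have /andP[h1 h2] := mP i.
have uE : r * u i = `|coord y i| by rewrite mulrC divfK// gt_eqF.
have {h1}h1 : r * (m i)%:R <= `|coord y i| + r / 2.
  by rewrite -uE -mulrDr ler_pM2l.
have {h2}h2 : `|coord y i| <= r * (m i)%:R + r / 2.
  rewrite -uE -lerBlDr -mulrBr ler_pM2l//.
  by move: h2; lra.
rewrite ler_norml; case: ltP => yi; [rewrite expr1|rewrite expr0].
  by move: h1 h2; rewrite (ltr0_norm yi) => h1 h2; apply/andP; split; lra.
by move: h1 h2; rewrite (ger0_norm yi) => h1 h2; apply/andP; split; lra.
Qed.

Lemma second_moment_tail sigma r : (0 < n)%N -> 0 < r ->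
  (forall i, \int[sigma]_y (coord y i ^+ 2)%:E <= (r ^+ 2)%:E)%E ->
  2^-1 <= fine (sigma [set y | \sum_(i < n) (coord y i / r) ^+ 2 <= (n + n)%:R]).
Proof.
move=> n0 r0 mom; pose q y := \sum_(i < n) (coord y i / r) ^+ 2.
have mc i : measurable_fun setT (fun y : Rn => (coord y i / r) ^+ 2).
  apply: measurable_funX; apply: measurable_funM; first exact: measurable_coord.
  exact: measurable_cst.
have mq : measurable_fun setT q by exact: measurable_sum.
pose G := [set y | q y <= (n + n)%:R].
have mG : measurable G by apply: measurable_set_le => //; exact: measurable_cst.
have Iq : (\int[sigma]_y (q y)%:E <= n%:R%:E)%E.
  rewrite (_ : (fun y => (q y)%:E) =
    (fun y => \sum_(i < n) ((coord y i / r) ^+ 2)%:E)%E); last first.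
    by apply/funext => y; rewrite sumEFin.
  rewrite ge0_integral_sum//; last 2 first.
  - by move=> i; exact/measurable_EFinP.
  - by move=> i y _; rewrite lee_fin sqr_ge0.
  apply: (@le_trans _ _ (\sum_(i < n) 1%:E)%E).
    apply: lee_sum => i _; under eq_integral do rewrite exprMn mulrC EFinM.
    rewrite ge0_integralZl ?lee_fin ?sqr_ge0//; last 2 first.
    - by apply/measurable_EFinP; apply: measurable_funX; exact: measurable_coord.
    - by move=> y _; rewrite lee_fin sqr_ge0.
    apply: (@le_trans _ _ ((r^-1 ^+ 2)%:E * (r ^+ 2)%:E)%E).
      by rewrite lee_wpmul2l// lee_fin sqr_ge0.
    by rewrite -EFinM lee_fin exprVn mulVf// expf_neq0// gt_eqF.
  by rewrite sumEFin sumr_const card_ord.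
have : ((n + n)%:R%:E * sigma (~` G) <= n%:R%:E)%E.
  apply: le_trans Iq.
  rewrite -[X in sigma X]setIT -integral_indic//; last exact: measurableC.
  have mGC : measurable_fun setT (fun y => (\1_(~` G) y : R)%:E).
    by apply/measurable_EFinP; apply: measurable_indic; exact: measurableC.
  rewrite -ge0_integralZl//; try by move=> x _; rewrite lee_fin.
  apply: ge0_le_integral => //.
  - exact: emeasurable_funM.
  - exact/measurable_EFinP.
  - move=> y _; rewrite -EFinM lee_fin indicE; case: (boolP (y \in _)).
      by rewrite inE mulr1 /G/= => /negP; rewrite -ltNge => /ltW.
    by rewrite mulr0 sumr_ge0// => i _; rewrite sqr_ge0.
rewrite probability_setC// -[sigma G]fineK ?fin_num_measure// -EFinB -EFinM lee_fin.
have n0' : 0 < n%:R :> R by rewrite ltr0n.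
rewrite natrD -[leRHS]mulr1 (_ : (n%:R + n%:R) * _ =
   n%:R * (2 * (1 - fine (sigma G)))); last by ring.
by rewrite ler_pM2l//; rewrite /G; lra.
Qed.

(* Half of the mass lies in the l^1-type region covered by the boxes centred at
   r * z with z integral and |z|_1 <= 2 n, and there are at most 16 ^ n of them. *)
Lemma box_mode sigma r : (0 < n)%N -> 0 < r ->
  (forall i, \int[sigma]_y (coord y i ^+ 2)%:E <= (r ^+ 2)%:E)%E ->
  exists a, 64 ^- n <= box_mass sigma (r / 2) a.
Proof.
move=> n0 r0 mom; have half := second_moment_tail n0 r0 mom.
set G := mkset _ in half.
have mG : measurable G.
  apply: measurable_set_le; last exact: measurable_cst.
  apply: measurable_sum => i; apply: measurable_funX; apply: measurable_funM.
    exact: measurable_coord.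
  exact: measurable_cst.
apply: contrapT => no.
have small a : box_mass sigma (r / 2) a <= 64 ^- n.
  by rewrite leNgt; apply/negP => h; apply: no; exists a; exact: ltW.
have := @fine_measure_cover _ _ _ sigma _ (enum grid_set) (fun p => box (grid r p) (r / 2)) G.
move=> /(_ (fun p => measurable_box _ _) mG).
have cov x : G x -> exists2 p, p \in enum grid_set & box (grid r p) (r / 2) x.
  by move=> /(grid_cover r0)[p ps px]; exists p => //; rewrite mem_enum.
move=> /(_ cov); apply/negP; rewrite -ltNge.
apply: lt_le_trans half; rewrite big_enum/=.
apply: (@le_lt_trans _ _ (\sum_(p in grid_set) 64 ^- n)).
  by apply: ler_sum => p _; exact: small.
rewrite sumr_const -[ltLHS]mulr_natl.
apply: (@le_lt_trans _ _ (16 ^+ n / 64 ^+ n)).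
  apply: ler_wpM2r; first by rewrite invr_ge0 exprn_ge0.
  by rewrite -natrX ler_nat card_grid_set.
rewrite -expr_div_n (_ : 16 / 64 = 4^-1); last by field.
apply: (@le_lt_trans _ _ (4^-1 ^+ 1)); last by rewrite expr1; lra.
by rewrite ler_wiXn2l//; lra.
Qed.

End mode.

(** * Separation from closed convex sets *)

Section separation.
Context {R : realType} {n : nat}.
Notation Rn := (n.-tuple R).
Implicit Types (x y z : Rn) (B : set Rn).

Definition sqdist z y : R := \sum_(i < n) (coord y i - coord z i) ^+ 2.

Lemma sqdist_box z y : box z (sqdist z y + 1) y.
Proof.
move=> i; have h : (coord y i - coord z i) ^+ 2 <= sqdist z y.
  by rewrite /sqdist (bigD1 i)//= lerDl sumr_ge0// => j _; rewrite sqr_ge0.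
rewrite -real_normK ?num_real// in h.
have := sqr_ge0 (`|coord y i - coord z i| - 1); rewrite sqrrB1.
by have := normr_ge0 (coord y i - coord z i); lra.
Qed.

Lemma nearest_point B z : box_closed B -> B !=set0 ->
  exists2 p, B p & forall y, B y -> sqdist z p <= sqdist z y.
Proof.
move=> cB [y0 By0]; pose r := sqdist z y0 + 1.
have cK : box_closed (B `&` box z r) by apply: box_closedI => //; exact: box_closed_box.
have kK : compact_set (B `&` box z r) by apply: (@box_closed_compact _ _ _ z r) => // x [].
pose q (v : 'rV[R]_n) : R := \sum_(i < n) (v ord0 i - coord z i) ^+ 2.
have qE y : q (row_of y) = sqdist z y by apply: eq_bigr => i _; rewrite mxE.
have cc i : continuous (fun v : 'rV[R]_n => (v ord0 i - coord z i) ^+ 2).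
  move=> v.
  have h1 : (fun w : 'rV[R]_n => w ord0 i) @ v --> v ord0 i.
    exact: normedtype_theory.matrix_normedtype.coord_continuous.
  have h : (fun w : 'rV[R]_n => w ord0 i - coord z i) @ v --> v ord0 i - coord z i.
    exact: (cvgB h1 (cvg_cst (coord z i))).
  exact: (cvgM h h).
have cq : {within @row_of R n @` (B `&` box z r), continuous q}.
  apply: continuous_subspaceT => v.
  apply: cvg_big; [exact: add_continuous|exact: (@nbhs_filter _ v)|move=> i _].
  exact: cc.
have [|v] := compact_EVT_min _ kK cq.
  by exists (row_of y0), y0 => //; split => //; exact: sqdist_box.
rewrite inE => -[p [Bp zp] <-] pmin; exists p => // y By.
have [yr|yr] := leP (sqdist z y) (sqdist z y0).
  rewrite -!qE; apply: pmin; rewrite inE; exists y => //; split => //.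
  by move=> i; rewrite (le_trans (sqdist_box z y i))// lerD2r.
apply: le_trans (ltW yr); rewrite -!qE; apply: pmin; rewrite inE; exists y0 => //.
by split => //; exact: sqdist_box.
Qed.

Lemma separation B z : (0 < n)%N -> box_closed B ->
  (forall t x y, 0 < t < 1 -> B x -> B y -> B (lincomb t x y)) -> ~ B z ->
  exists th : Rn, th != [tuple 0 | i < n] /\ forall y, B y -> dotp th y < dotp th z.
Proof.
move=> n0 cB vB nBz; have [->|/set0P B0] := eqVneq B set0.
  exists [tuple 1 | i < n]; split => //; apply/eqP => /(congr1 (fun x => coord x (Ordinal n0))).
  by rewrite !coordE => /eqP; rewrite oner_eq0.
have [p Bp pmin] := nearest_point z cB B0.
pose th := subt z p; have thi i : coord th i = coord z i - coord p i by rewrite coordE.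
have th0 : th != [tuple 0 | i < n].
  apply/eqP => h; apply: nBz; rewrite (_ : z = p)//; apply: coordP => i.
  by move/(congr1 (fun x => coord x i)): h; rewrite thi coordE => /subr0_eq.
exists th; split => // y By.
have pz : 0 < sqdist z p.
  rewrite lt_def sumr_ge0 ?andbT; last by move=> i _; rewrite sqr_ge0.
  apply: contra th0; rewrite /sqdist psumr_eq0; last by move=> i _; rewrite sqr_ge0.
  move=> /allP h; apply/eqP; apply: coordP => i; rewrite thi coordE.
  have := h i (mem_index_enum i); rewrite sqrf_eq0/= => /eqP e.
  by rewrite -[LHS]opprK opprB e oppr0.
pose c := \sum_(i < n) (coord y i - coord p i) * (coord p i - coord z i).
pose e := sqdist p y.
have e0 : 0 <= e by apply: sumr_ge0 => i _; rewrite sqr_ge0.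
have quad t : 0 < t < 1 -> 0 <= t * e + 2 * c.
  move=> t01; have := pmin _ (vB t y p t01 By Bp); case/andP: t01 => t0 t1.
  have -> : sqdist z (lincomb t y p) = sqdist z p + t * (t * e + 2 * c).
    rewrite /e /c /sqdist !mulr_sumr -!big_split/= mulr_sumr -big_split/=.
    by apply: eq_bigr => i _; rewrite coordE; ring.
  by rewrite lerDl pmulr_rge0.
have c0 : 0 <= c.
  rewrite leNgt; apply/negP => c0.
  pose t := - c / (e - c).
  have d0 : 0 < e - c by lra.
  have t0 : 0 < t by rewrite divr_gt0// oppr_gt0.
  have [|t1] := ltP t 1.
    move=> t1; have /quad : 0 < t < 1 by rewrite t0.
    have : t * e <= - c.
      rewrite /t mulrAC ler_pdivrMr// ler_wpM2l ?oppr_ge0 ?(ltW c0)//; lra.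
    by lra.
  have : 1 * (e - c) <= - c by rewrite -ler_pdivlMr.
  move=> h; have e00 : e = 0 by lra.
  have /quad : 0 < (2^-1 : R) < 1 by rewrite invr_gt0 ltr0n invf_lt1 ?ltr1n.
  by rewrite e00; lra.
rewrite -subr_gt0.
have -> : dotp th z - dotp th y = sqdist z p + c; last by rewrite ltr_wpDr.
rewrite /dotp /sqdist /c -sumrB -big_split/=; apply: eq_bigr => i _.
by rewrite thi; ring.
Qed.

End separation.

(** * Half-space depth *)

(* Measurability of the depth function is not available; the integral of a
   nonnegative function is monotone without it, being a supremum over simple
   functions below. *)
Lemma le_integral_nonmeasurable d (T : measurableType d) (R : realType)
    (P : {measure set T -> \bar R}) (f g : T -> \bar R) :
  (forall x, 0 <= f x)%E -> (forall x, f x <= g x)%E ->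
  (\int[P]_x f x <= \int[P]_x g x)%E.
Proof.
move=> f0 fg; have g0 x : (0 <= g x)%E by exact: le_trans (f0 x) (fg x).
rewrite !ge0_integralTE//; apply: le_ereal_sup => _ [h hf <-].
by exists h => // x; exact: le_trans (hf x) (fg x).
Qed.

Lemma expRN1_ge (R : realType) : 4^-1 <= expR (- 1 : R).
Proof.
have -> : (- 1 : R) = - 2^-1 + - 2^-1 by field.
rewrite expRD; have : (2^-1 : R) <= expR (- 2^-1).
  by apply: le_trans (expR_ge1Dx _); lra.
by move=> h; have := ler_pM _ _ h h; rewrite invr_ge0 => /(_ (ler0n _ _) (ler0n _ _)); lra.
Qed.

Lemma exp4_le_expR (R : realType) n : 4 ^- n <= expR (- n%:R : R).
Proof.
have -> : (- n%:R : R) = n%:R * - 1 by rewrite mulrN1.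
by rewrite expRM_natl -exprVn lerXn2r ?nnegrE ?expR_ge0 ?expRN1_ge.
Qed.

Lemma ler_root (R : realType) (a b : R) n : (0 < n)%N -> 0 <= a -> 0 <= b ->
  a ^+ n <= b ^+ n -> a <= b.
Proof. by move=> n0 a0 b0; rewrite ler_pXn2r ?nnegrE. Qed.

(* Used with q ^+ 4 = expR (- n / m) and k = 4 ^- n: no constant factor may be lost
   in the sum of the two error terms, since n / m can be close to 0. *)
Lemma mix_le_root4 (R : realType) (q k : R) : 0 < q -> q <= 1 -> 0 <= k -> k <= 4^-1 ->
  k <= q ^+ 4 -> q ^+ 4 + (1 - q ^+ 4) * k <= q.
Proof.
move=> q0 q1 k0 k4 kq; have q41 : q ^+ 4 <= 1 by rewrite exprn_ile1// ltW.
have [h|h] := leP 2^-1 q.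
  have : (1 - q ^+ 4) * k <= (1 - q ^+ 4) * 4^-1 by rewrite ler_wpM2l// subr_ge0.
  have : 0 <= (1 - q) * (3 * (q * (1 + q + q * q)) - 1) by apply: mulr_ge0; nra.
  have -> : (1 - q) * (3 * (q * (1 + q + q * q)) - 1) = 4 * q - 1 - 3 * q ^+ 4 by ring.
  by lra.
have : (1 - q ^+ 4) * k <= q ^+ 4.
  by apply: le_trans kq; rewrite ler_piMl// gerBl exprn_ge0// ltW.
have : q ^+ 4 <= q / 8.
  rewrite exprS ler_pM2l// -[leRHS](_ : 2^-1 ^+ 3 = 8^-1); last by field.
  by rewrite lerXn2r ?nnegrE ?ltW.
by lra.
Qed.

Section depth.
Context {R : realType} {n : nat}.
Notation Rn := (n.-tuple R).
Implicit Types (x y z : Rn) (mu nu : probability Rn R).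

Lemma depth_ge0 mu x : (0 <= depth mu x)%E.
Proof. by apply: le_ereal_inf_tmp => _ [H _ <-]. Qed.

Lemma depth_le_halfspace mu (th x : Rn) : th != [tuple 0 | i < n] ->
  (depth mu x <= mu [set y | (dotp th x <= dotp th y)%R])%E.
Proof.
move=> th0; apply: ereal_inf_lbound; exists [set y | dotp th x <= dotp th y] => //.
by split => /=; [exists th, (dotp th x)|exact: lexx].
Qed.

Lemma measurable_halfspace (th : Rn) s : measurable [set y : Rn | s <= dotp th y].
Proof. by apply: measurable_set_le; [exact: measurable_cst|exact: measurable_dotp]. Qed.

Lemma depth_le1 mu x : (0 < n)%N -> (depth mu x <= 1)%E.
Proof.
move=> n0; have th0 : [tuple (1 : R) | i < n] != [tuple 0 | i < n].
  apply/eqP => /(congr1 (fun x => coord x (Ordinal n0))).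
  by rewrite !coordE => /eqP; rewrite oner_eq0.
by rewrite (le_trans (depth_le_halfspace _ _ th0))// probability_le1//; exact: measurable_halfspace.
Qed.

Variable lam : {measure set Rn -> \bar R}.
Hypothesis lamP : is_lebesgue lam.

Lemma depth_small mu m x : (0 < n)%N -> (0 < m)%N ->
  log_concave_measure mu -> isotropic mu ->
  box_mass (sum_law mu m) (Num.sqrt m%:R) (afft m%:R origin x) < 64 ^- n * 64 ^- n ->
  (depth mu x <= (expR (- (n%:R / m%:R)))%:E)%E.
Proof.
move=> n0 m0 lc iso; set sg := sum_law mu m; set r := Num.sqrt _ => xsmall.
have m0' : 0 < m%:R :> R by rewrite ltr0n.
have r0 : 0 < r by rewrite sqrtr_gt0.
have [a amode] : exists a, 64 ^- n <= box_mass sg (r / 2) a.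
  apply: box_mode => // i; rewrite sum_law_moment// lee_fin sqr_sqrtr//; exact: ltW.
have a0 : 0 < box_mass sg (r / 2) a by rewrite (lt_le_trans _ amode)// invr_gt0 exprn_gt0.
set e := 64 ^- n * 64 ^- n in xsmall.
have e0 : 0 < e by rewrite mulr_gt0// invr_gt0 exprn_gt0.
pose E := [set y | box_mass sg r y < e].
have h01 : 0 < (2^-1 : R) < 1 by rewrite invr_gt0 ltr0n invf_lt1 ?ltr1n.
have tailE : fine (sg E) <= 4 ^- n.
  have lch y : box_mass sg (r / 2) y `^ 2^-1 * box_mass sg (r / 2) a `^ (1 - 2^-1) <=
      box_mass sg (r / 2) (lincomb 2^-1 y a) by exact: box_mass_sum_law_log_concave.
  apply: le_trans (tail_box_mass lamP r0 (ltW e0) a0 lch) _.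
  apply: (@le_trans _ _ (2 ^+ n * Num.sqrt ((8^-1 ^+ n) ^+ 2))).
    rewrite ler_pM2l ?exprn_gt0// ler_wsqrtr// ler_pdivrMr//.
    apply: (@le_trans _ _ ((8^-1 ^+ n) ^+ 2 * 64 ^- n)); last first.
      by rewrite ler_wpM2l// sqr_ge0.
    rewrite /e -exprVn -exprM mulnC exprM (_ : 8^-1 ^+ 2 = 64^-1)//.
    by field.
  rewrite sqrtr_sqr ger0_norm ?exprn_ge0// -exprMn -exprVn le_eqVlt; apply/orP; left.
  by apply/eqP; congr (_ ^+ _); field.
pose B := [set y | e <= box_mass sg r y].
have cB : box_closed B by exact: superlevel_closed_box_mass.
have vB t y z : 0 < t < 1 -> B y -> B z -> B (lincomb t y z).
  move=> t01 By Bz; apply: le_trans (box_mass_sum_law_log_concave m r y z lc t01).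
  have -> : e = e `^ t * e `^ (1 - t).
    by rewrite -powRD ?(gt_eqF e0) ?implybT// subrKC powRr1// ltW.
  case/andP: t01 => t0 t1.
  apply: ler_pM; rewrite ?powR_ge0//; apply: ge0_ler_powR;
    by rewrite ?nnegrE ?box_mass_ge0 ?subr_ge0 ?(ltW e0) ?(ltW t0) ?(ltW t1).
have nB : ~ B (afft m%:R origin x) by rewrite /B/= => /le_lt_trans/(_ xsmall); rewrite ltxx.
have [th [th0 thB]] := separation n0 cB vB nB.
have dz : dotp th (afft m%:R origin x) = m%:R * dotp th x.
  by rewrite /dotp mulr_sumr; apply: eq_bigr => i _; rewrite !coordE addr0; ring.
apply: le_trans (depth_le_halfspace mu x th0) _.
rewrite -[X in (X <= _)%E]fineK ?fin_num_measure//; last exact: measurable_halfspace.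
rewrite lee_fin; apply: (ler_root m0); rewrite ?fine_ge0 ?expR_ge0//.
apply: le_trans (sum_law_halfspace mu m th (dotp th x)) _.
apply: (@le_trans _ _ (fine (sg E))).
  apply: fine_le_measure; first exact: measurable_halfspace.
    by apply: measurable_set_lt; [exact: measurable_box_mass|exact: measurable_cst].
  move=> y /= hy; rewrite /E/= ltNge; apply/negP => /thB.
  by rewrite dz ltNge hy.
apply: (le_trans tailE); rewrite -expRM_natl mulrN mulrC divfK ?gt_eqF//.
exact: exp4_le_expR.
Qed.

Lemma density_bound nu (f : Rn -> R) (M : R) (A : set Rn) : is_density lam nu f ->
  (forall x, f x <= M) -> measurable A -> (nu A <= M%:E * lam A)%E.
Proof.
move=> [f0 [mf nuE]] fM mA; rewrite nuE//.
apply: (@le_trans _ _ (\int[lam]_(x in A) (cst M%:E) x)%E); last by rewrite integral_cst.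
apply: ge0_le_integral => //.
- by move=> x _; rewrite lee_fin.
- by apply/measurable_EFinP; exact: measurable_funS mf.
- by move=> x _; rewrite lee_fin.
Qed.

Lemma density_sup_ge nu (f : Rn -> R) (M : R) : (0 < n)%N -> isotropic nu ->
  is_density lam nu f -> (forall x, f x <= M) -> 64 ^- n <= M.
Proof.
move=> n0 [_ [_ [_ cov]]] df fM.
have [a ha] : exists a, 64 ^- n <= box_mass nu (1 / 2) a.
  apply: box_mode => // i; under eq_integral do rewrite expr2.
  by rewrite cov eqxx expr1n.
apply: le_trans ha _; rewrite -lee_fin /box_mass fineK ?fin_num_measure//;
  last exact: measurable_box.
apply: le_trans (density_bound df fM (measurable_box a (1 / 2))) _.
rewrite (lebesgue_box lamP) ?divr_ge0// -EFinM lee_fin.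
by rewrite mul1r mulfV ?expr1n ?mulr1// pnatr_eq0.
Qed.

Lemma integral_depth_le mu nu (f : Rn -> R) (L : R) m : (0 < n)%N -> (0 < m)%N ->
  log_concave_measure mu -> isotropic mu -> is_density lam nu f ->
  0 <= L -> (forall x, f x <= L ^+ n) -> 2 ^+ 15 * L <= Num.sqrt m%:R ->
  (\int[nu]_x depth mu x <= (expR (- (n%:R / m%:R / 4)))%:E)%E.
Proof.
move=> n0 m0 lc iso df L0 fL mL; set r := Num.sqrt _ in mL.
have m0' : 0 < m%:R :> R by rewrite ltr0n.
have r0 : 0 < r by rewrite sqrtr_gt0.
pose s : R := n%:R / m%:R.
pose D := [set x | 64 ^- n * 64 ^- n <= box_mass (sum_law mu m) r (afft m%:R origin x)].
have mD : measurable D.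
  apply: measurable_set_le; first exact: measurable_cst.
  by apply: measurableT_comp; [exact: measurable_box_mass|exact: measurable_afft].
have nuD : (nu D <= (4 ^- n)%:E)%E.
  have e0 : 0 < (64 ^- n * 64 ^- n : R) by rewrite mulr_gt0// invr_gt0 exprn_gt0.
  apply: le_trans (density_bound df fL mD) _.
  apply: (@le_trans _ _ ((L ^+ n)%:E * ((2 * (r / m%:R)) ^+ n / (64 ^- n * 64 ^- n))%:E)%E).
    by rewrite lee_wpmul2l ?lee_fin ?exprn_ge0// volume_box_mass// ltW.
  rewrite -EFinM lee_fin invfM !invrK -!exprMn -exprVn lerXn2r ?nnegrE//.
    by rewrite !mulr_ge0// ?invr_ge0 ?(ltW r0) ?(ltW m0').
  have -> : m%:R = r * r :> R by rewrite -expr2 sqr_sqrtr// ltW.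
  rewrite (_ : L * _ = 2 ^+ 13 * L / r); last by field; exact: lt0r_neq0.
  by rewrite ler_pdivrMr//; move: mL; lra.
have s0 : 0 <= s by rewrite divr_ge0.
have es1 : expR (- s) <= 1 by rewrite -expR0 ler_expR oppr_le0.
apply: (@le_trans _ _ (\int[nu]_x ((expR (- s))%:E + ((1 - expR (- s)) * \1_D x)%:E))%E).
  apply: le_integral_nonmeasurable => x; first exact: depth_ge0.
  rewrite -EFinD indicE; case: (boolP (x \in D)) => xD.
    by rewrite mulr1 addrC subrK depth_le1.
  rewrite mulr0 addr0; apply: (depth_small n0 m0 lc iso).
  by move: xD; rewrite notin_setE /D/= => /negP; rewrite -ltNge.
have mI : measurable_fun setT (fun x => ((1 - expR (- s)) * \1_D x)%:E).
  by apply/measurable_EFinP; apply: measurable_funM => //; exact: measurable_cst.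
rewrite ge0_integralD//; last by move=> x _; rewrite lee_fin mulr_ge0// subr_ge0.
rewrite integral_probability_cst; under eq_integral do rewrite EFinM.
rewrite ge0_integralZl ?lee_fin ?subr_ge0//; last exact/measurable_EFinP.
rewrite integral_indic// setIT -[X in (_ * X)%E]fineK ?fin_num_measure// -EFinM -EFinD lee_fin.
have nuD' : fine (nu D) <= 4 ^- n by rewrite -lee_fin fineK ?fin_num_measure.
pose q := expR (- (s / 4)).
have qE : expR (- s) = q ^+ 4 by rewrite -expRM_natl; congr expR; field.
rewrite -/s -/q; apply: (@le_trans _ _ (expR (- s) + (1 - expR (- s)) * 4 ^- n)).
  by rewrite lerD2l ler_wpM2l// subr_ge0.
rewrite qE; apply: mix_le_root4.
- exact: expR_gt0.
- by rewrite -expR0 ler_expR oppr_le0 divr_ge0.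
- by rewrite invr_ge0 exprn_ge0.
- rewrite lef_pV2 ?posrE ?exprn_gt0// -[leLHS]expr1; apply: ler_weXn2l => //.
  by rewrite ler1n.
- rewrite -qE (le_trans (exp4_le_expR R n))// ler_expR lerN2 /s ler_pdivrMr//.
  by rewrite ler_peMr// ler1n.
Qed.

End depth.

Theorem theorem1p2 (R : realType) :
  exists (c : R) (n0 : nat), 0 < c /\
  forall (n : nat), (n0 <= n)%N ->
  forall (lam : {measure set (n.-tuple R) -> \bar R}), is_lebesgue lam ->
  forall (mu nu : probability (n.-tuple R) R) (f : n.-tuple R -> R),
    log_concave_measure mu -> isotropic mu ->
    log_concave_measure nu -> isotropic nu ->
    is_density lam nu f -> log_concave_fun f ->
    (\int[nu]_x depth mu x <=
      (expR (- (c * n%:R) / (isotropic_constant f) ^+ 2))%:E)%E.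
Proof.
exists ((2 ^+ 33)^-1), 1%N; split; first by rewrite invr_gt0 exprn_gt0.
move=> n n0 lam lamP mu nu f lc iso _ isonu df _.
have n0' : 0 < n%:R :> R by rewrite ltr0n.
set L := isotropic_constant f.
(* For unbounded f the supremum is the junk value 0, so that L = 0, x / 0 = 0, and
   the bound to prove is 1. *)
have [sf|nsf] := pselect (has_sup (range f)); last first.
  have -> : L = 0 by rewrite /L /isotropic_constant sup_out// powR0// invr_neq0// gt_eqF.
  rewrite expr0n invr0 mulr0 expR0 -(integral_probability_cst nu).
  by apply: le_integral_nonmeasurable => x; [exact: depth_ge0|exact: depth_le1].
pose M := sup (range f).
have fM x : f x <= M by apply: ub_le_sup; [exact: sf.2|exists x].
have M64 : 64 ^- n <= M := density_sup_ge lamP n0 isonu df fM.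
have M0 : 0 < M by rewrite (lt_le_trans _ M64)// invr_gt0 exprn_gt0.
have LM : L ^+ n = M.
  rewrite /L /isotropic_constant -powR_mulrn ?powR_ge0// -powRrM mulVf ?gt_eqF// powRr1//.
  exact: ltW.
have L0 : 0 <= L by exact: powR_ge0.
have L64 : 64^-1 <= L by apply: (ler_root n0) => //; rewrite LM exprVn.
have Lp : 0 < L by apply: lt_le_trans L64; rewrite invr_gt0.
pose K : R := 2 ^+ 30 * L ^+ 2.
have K1 : 1 <= K.
  apply: (@le_trans _ _ (2 ^+ 30 * 64^-1 ^+ 2)); last first.
    by rewrite ler_pM2l ?exprn_gt0// lerXn2r ?nnegrE.
  rewrite (_ : 2 ^+ 30 * 64^-1 ^+ 2 = 2 ^+ 18); last by field.
  by rewrite exprn_ege1// ler1n.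
pose m := (Num.trunc K).+1.
have /andP[mK1 mK2] : K <= m%:R <= 2 * K.
  have K0 : 0 <= K by lra.
  have /andP[h1 /ltW h2] := truncn_itv K0.
  by rewrite h2/= /m -natr1; lra.
apply: le_trans (integral_depth_le (m := m) lamP n0 _ lc iso df L0 _ _) _ => //.
- by move=> x; rewrite LM.
- rewrite -[leLHS]ger0_norm ?mulr_ge0 ?exprn_ge0// -sqrtr_sqr ler_wsqrtr//.
  by apply: le_trans mK1; rewrite /K exprMn -exprM.
rewrite lee_fin ler_expR mulNr lerN2.
have m0 : 0 < m%:R :> R by rewrite ltr0n.
have L20 : 0 < L ^+ 2 by rewrite exprn_gt0.
rewrite -[leRHS]mulrA -invfM mulrAC mulrC -invfM ler_pM2l// lef_pV2 ?posrE ?mulr_gt0 ?exprn_gt0//.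
by rewrite /K in mK2; lra.
Qed.
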